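(* Let $k \geq 1$, let $X$ be a process satisfying general self-similarity with $\mathcal{C}^k$ invariance components on a connected $\mathcal{C}^k$-differentiable manifold $\mathcal{M}$, and let $y_0$ be an element of $\mathcal{M}$. Assume that either Assumption 1 or Assumption 2 is satisfied for $E=\mathcal{M}$ and that $Sym(X_{y_0})$ is discrete. Then $X$ admits a family of $\mathcal{C}^k$ good invariance components relatively to the reference point $y_0$.
   Context: Processes and life-time. Let $E$ be a locally compact separable metric space. A strongly Markovian càdlàg process $X$ on $E$ is given through the processes $X_y$ ($y\in E$), $X_y$ being $X$ started from $y$; $P_y$ is the law of $X_y$. The process $X_y$ may have a finite life-time $\zeta(X_y)\in(0,+\infty]$, namely the time at which every compact subset of $E$ containing $y$ has been left by $X_y$. If $\mathbb{P}(\zeta(X_y)<+\infty)>0$ one adds a cemetery point $\Delta$ to $E$, whose neighborhoods are the sets $K^c\cup\{\Delta\}$, $K\subset E$ compact, and puts $X_y(t)=\Delta$ for $t\ge \zeta(X_y)$. There is no instantaneous killing: $\Delta$ is absorbing and can only be reached continuously. A homeomorphism $f$ of $E$ is extended to $E\cup\{\Delta\}$ by $f(\Delta)=\Delta$. General self-similarity. $X$ satisfies general self-similarity on $E$ if for some point $y_0\in E$, $$\forall y\in E,\ (X_y(t),\ t\ge 0)\overset{\mathcal L}{=}(f_y(X_{y_0}(c_y t)),\ t\ge 0),$$ where $(f_y,\ y\in E)$ is a family of homeomorphisms of $E$ such that $(y,x)\mapsto f_y(x)$ and $(y,x)\mapsto f_y^{-1}(x)$ are continuous from $E\times E$ to $E$,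 and $(c_y,\ y\in E)$ is a family of positive constants with $y\mapsto c_y$ continuous. Then $((f_y,c_y),\ y\in E)$ is called a family of invariance components for $X$ relatively to the reference point $y_0$. (The reference point can be chosen arbitrarily: if $((f_y,c_y))$ are invariance components relatively to some $y_1$, then $((f_y\circ f_{y_2}^{-1},c_y/c_{y_2}))$ are invariance components relatively to $y_2$.) $\mathcal{C}^k$ invariance components. If $E$ is a $\mathcal{C}^k$-differentiable manifold, invariance components are called $\mathcal{C}^k$ if $(y,x)\mapsto f_y(x)$, $(y,x)\mapsto f_y^{-1}(x)$ and $y\mapsto c_y$ are of class $\mathcal{C}^k$. Good invariance components. Invariance components $((f_y,c_y),\ y\in E)$ relatively to $y_0$ are called good if $f_{y_0}=id_E$, $c_{y_0}=1$, and $c_{f_y(z)}=c_y\times c_z$ for all $y,z\in E$. Support, symmetries and assumptions. $Supp(X_y):=\overline{\bigcup_{t\ge0}Supp(X_y(t))}=\{z\in E:\ \forall\epsilon>0,\ \exists t\ge0,\ \mathbb{P}(X_y(t)\in B(z,\epsilon))>0\}$. Assumption 1: $E=Supp(X_{y_0})$. Assumption 2: there exists $y\in E$ such that $y$ belongs to the interior of $Supp(X_y)$. $Sym(X_y):=\{h\in Hom(E):\ X_y\overset{\mathcal L}{=}h(X_y)\}$, where $Hom(E)$ is the group of homeomorphisms of $E$; it is regarded as a subset of $\mathcal{C}^0(E,E)$ with the topology of uniform convergence on compact sets, and ''discrete'' refers to this topology. *)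

(* Defs.v *)
From HB Require Import structures.
From mathcomp Require Import all_boot all_order all_algebra.
From mathcomp Require Import all_classical all_reals all_analysis.
From mathcomp Require Import measurable_realfun.
Set Implicit Arguments.
Unset Strict Implicit.
Unset Printing Implicit Defensive.
Import Order.TTheory GRing.Theory Num.Theory.
Import numFieldNormedType.Exports.
Local Open Scope classical_set_scope.
Local Open Scope ring_scope.

(* The state space with its cemetery point: [None] is the cemetery, and its
   neighborhoods are the sets containing the complement of a (closed) compact
   subset of [E]; on a compact [E] it is an isolated point. *)
Notation cemetery := one_point_compactification.

Section Topology.
Variable E : topologicalType.

Record homeo := Homeo {
  homeo_fun :> E -> E ;
  homeo_inv : E -> E ;
  homeo_funK : cancel homeo_fun homeo_inv ;
  homeo_invK : cancel homeo_inv homeo_fun ;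
  homeo_fun_continuous : continuous homeo_fun ;
  homeo_inv_continuous : continuous homeo_inv }.

Definition separable_space := exists2 D : set E, countable D & dense D.

Definition borel_cemetery := g_sigma_algebraType (@open (cemetery E)).

End Topology.

Section CkEuclidean.
Context {R : realType} {V W : normedModType R}.

(* [Ck k U f]: on the open set [U], all iterated directional derivatives of [f]
   of order at most [k] exist and are continuous. It is only used for
   finite-dimensional [V]. *)
Fixpoint Ck (k : nat) (U : set V) (f : V -> W) : Prop :=
  (forall x, U x -> {for x, continuous f}) /\
  if k is k'.+1 then
    (forall x v, U x -> derivable f x v) /\ (forall v, Ck k' U ('D_v f))
  else True.

End CkEuclidean.

Section CkManifold.
Context {R : realType} (M : topologicalType) (n : nat).

Record chart := Chart {
  chart_dom : set M ;
  coord : M -> 'rV[R]_n ;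
  param : 'rV[R]_n -> M ;
  chart_dom_open : open chart_dom ;
  chart_codom_open : open (coord @` chart_dom) ;
  coordK : forall x, chart_dom x -> param (coord x) = x ;
  coord_continuous : forall x, chart_dom x -> {for x, continuous coord} ;
  param_continuous :
    forall u, (coord @` chart_dom) u -> {for u, continuous param} }.

Definition chart_codom (a : chart) : set 'rV[R]_n := coord a @` chart_dom a.

Record Ck_atlas (k : nat) := CkAtlas {
  atlas : set chart ;
  atlas_cover : forall x, exists2 a, atlas a & chart_dom a x ;
  atlas_compatible : forall a b, atlas a -> atlas b ->
    Ck k (coord a @` (chart_dom a `&` chart_dom b)) (coord b \o param a) }.

Definition Ck_fun (k : nat) (A : Ck_atlas k) (g : M -> R) : Prop :=
  continuous g /\
  forall a, atlas A a -> Ck k (chart_codom a) (g \o param a : _ -> R^o).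

(* maps of class C^k from the product manifold [M * M], with its product
   charts, to [M] *)
Definition Ck_map2 (k : nat) (A : Ck_atlas k) (F : M -> M -> M) : Prop :=
  continuous (fun p : M * M => F p.1 p.2) /\
  forall a b d, atlas A a -> atlas A b -> atlas A d ->
    Ck k [set p : 'rV[R]_n * 'rV[R]_n | [/\ chart_codom a p.1,
            chart_codom b p.2 & chart_dom d (F (param a p.1) (param b p.2))]]
         (fun p => coord d (F (param a p.1) (param b p.2))).

End CkManifold.

Section Paths.
Context {R : realType} (E : topologicalType).

(* Paths are indexed by [R], but only their values at nonnegative times ever
   matter. *)
Definition path_space := R -> cemetery E.

(* the sigma-algebra on paths generated by the evaluations at times t >= 0 *)
Definition path_sigma_algebra : set (set path_space) :=
  <<s [set C | exists2 t : R, 0 <= t &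
       exists2 B : set (borel_cemetery E), measurable B &
         C = [set w | B (w t)]] >>.

Definition exit_time (K : set E) (w : path_space) : \bar R :=
  ereal_inf [set t%:E | t in [set t : R | 0 <= t /\ ~ (Some @` K) (w t)]].

Definition lifetime (y : E) (w : path_space) : \bar R :=
  ereal_sup [set exit_time K w | K in [set K : set E | compact K /\ K y]].

(* cadlag path in [E] up to its life-time, absorbed in the cemetery from then
   on, the cemetery being reached continuously *)
Definition cadlag_from (y : E) (w : path_space) : Prop :=
  [/\ w 0 = Some y,
      (forall t, 0 <= t -> w s @[s --> t^'+] --> w t),
      (forall t, 0 < t -> (t%:E < lifetime y w)%E ->
         exists x : E, w s @[s --> t^'-] --> (Some x : cemetery E)),
      (forall t, 0 <= t -> w t = None <-> (lifetime y w <= t%:E)%E) &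
      (forall t, lifetime y w = t%:E ->
         w s @[s --> t^'-] --> (None : cemetery E))].

End Paths.
Arguments path_space : clear implicits.
Arguments path_sigma_algebra : clear implicits.

(* One process [X_y] for each starting point [y], each on its own probability
   space. *)
Record process (R : realType) (E : topologicalType) := Process {
  pr_display : measure_display ;
  Omega : E -> measurableType pr_display ;
  Pr : forall y, probability (Omega y) R ;
  traj : forall y, Omega y -> path_space R E ;
  traj_measurable : forall y t, 0 <= t ->
    measurable_fun [set: Omega y] (fun w => traj w t : borel_cemetery E) }.

Section Markov.
Context {R : realType} {E : topologicalType} (X : process R E).

(* the law of [X_y], extended to the absorbing cemetery point *)
Definition law (z : cemetery E) (A : set (path_space R E)) : \bar R :=
  if z is Some y then Pr X y (@traj _ _ X y @^-1` A)
  else (\1_A (fun=> None))%:E.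

Definition natural_filtration (y : E) (t : R) : set (set (Omega X y)) :=
  <<s [set C | exists2 s : R, 0 <= s <= t &
       exists2 B : set (borel_cemetery E), measurable B &
         C = [set w | B (traj w s)]] >>.

Definition stopping_time (y : E) (tau : Omega X y -> \bar R) : Prop :=
  (forall w, (0 <= tau w)%E) /\
  forall t, 0 <= t -> natural_filtration t [set w | (tau w <= t%:E)%E].

Definition stopped_event (y : E) (tau : Omega X y -> \bar R)
    (B : set (Omega X y)) : Prop :=
  measurable B /\
  forall t, 0 <= t -> natural_filtration t (B `&` [set w | (tau w <= t%:E)%E]).

(* The second clause says that, on [tau < +oo], the conditional law of
   [X_y (tau + .)] given the events prior to [tau] is that of the process
   started from [X_y tau]. *)
Definition strong_markov : Prop :=
  (forall A, path_sigma_algebra R E A ->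
     measurable_fun [set: borel_cemetery E] (law ^~ A)) /\
  (forall (y : E) (tau : Omega X y -> \bar R) B A,
     stopping_time tau -> stopped_event tau B -> path_sigma_algebra R E A ->
     Pr X y (B `&` [set w | (tau w < +oo)%E /\
                            A (fun t => traj w (fine (tau w) + t))]) =
     (\int[Pr X y]_(w in B `&` [set w | (tau w < +oo)%E])
        law (traj w (fine (tau w))) A)%E).

Definition strong_markov_cadlag : Prop :=
  (forall y (w : Omega X y), cadlag_from y (traj w)) /\ strong_markov.

End Markov.

Definition eq_law (R : realType) (E : topologicalType) (d1 d2 : measure_display)
    (T1 : measurableType d1) (T2 : measurableType d2)
    (P1 : probability T1 R) (P2 : probability T2 R)
    (Y1 : T1 -> path_space R E) (Y2 : T2 -> path_space R E) : Prop :=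
  forall A, path_sigma_algebra R E A -> P1 (Y1 @^-1` A) = P2 (Y2 @^-1` A).

Section SelfSimilarity.
Context {R : realType} {E : topologicalType} (X : process R E).

Definition invariance_components (y0 : E) (f : E -> homeo E) (c : E -> R) :
    Prop :=
  [/\ continuous (fun p : E * E => f p.1 p.2),
      continuous (fun p : E * E => homeo_inv (f p.1) p.2),
      (forall y, 0 < c y),
      continuous c &
      forall y, eq_law (Pr X y) (Pr X y0) (@traj _ _ X y)
        (fun w t => omap (f y) (traj w (c y * t)))].

Definition good_components (y0 : E) (f : E -> homeo E) (c : E -> R) : Prop :=
  [/\ invariance_components y0 f c, (forall x, f y0 x = x), c y0 = 1 &
      forall y z, c (f y z) = c y * c z].

Definition Ck_components (n k : nat) (A : @Ck_atlas R E n k)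
    (f : E -> homeo E) (c : E -> R) : Prop :=
  [/\ Ck_map2 A (fun y x => f y x),
      Ck_map2 A (fun y x => homeo_inv (f y) x) & Ck_fun A c].

Definition Sym (y : E) : set (E -> E) :=
  [set h : E -> E | exists2 g : homeo E, h = g :> (E -> E) &
     eq_law (Pr X y) (Pr X y) (@traj _ _ X y)
       (fun w t => omap h (traj w t))].

End SelfSimilarity.

(* for the topology of uniform convergence on compact sets *)
Definition discrete_in_compact_convergence (E : uniformType)
    (S : set (E -> E)) : Prop :=
  S `<=` isolated (S : set {family compact, E -> E}).

Section Support.
Context {R : realType} {E : metricType R} (X : process R E).

Definition Supp (y : E) : set E :=
  [set z | forall e : R, 0 < e -> exists2 t : R, 0 <= t &
     (0 < Pr X y [set w | exists2 x, ball z e x & traj w t = Some x])%E].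

Definition assumption1 (y0 : E) : Prop := Supp y0 = [set: E].

Definition assumption2 : Prop := exists y, (Supp y)^° y.

End Support.

(* Main.v *)
(* Write [f_y], [c_y] for the given components, normalised so that [f_{y0} = id]
   and [c_{y0} = 1]. The strong Markov property shows that [f_y (X_z (c_y .))] and
   [X_{f_y z}] have the same law for almost every visited point [z]; this extends
   to the whole support of [X_{y0}] because the pairs (homeomorphism, scale)
   preserving the law of [X_{y0}] are closed under limits, and the support is all
   of [M] (under assumption 2, it is open and closed). Hence
   [f_{f_y z}^-1 o f_y o f_z] maps [X_{y0}] to itself up to the time scale
   [r_y(z) = c_z c_y / c_{f_y z}].

   If [r] is identically 1, the components are good. Otherwise some [r_y] has a
   non-zero directional derivative, and the inverse function theorem along a
   line gives a C^k family of homeomorphisms [L_u], for small [u], that change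
   the scale of [X_{y0}] by [exp (d u)]. It is continued to a C^k family [G_u]
   over the real line, and [f_y o G_{- ln (c_y) / d}] are components with all
   scales equal to 1. *)
Require Import Defs.
From HB Require Import structures.
From mathcomp Require Import all_boot all_order all_algebra.
From mathcomp Require Import all_classical all_reals all_analysis.
From mathcomp Require Import measurable_realfun.
From mathcomp Require Import ring lra zify.
Import Order.TTheory GRing.Theory Num.Theory.
Import numFieldNormedType.Exports.
Import Defs.
Local Open Scope classical_set_scope.
Local Open Scope ring_scope.

Set Implicit Arguments.
Unset Strict Implicit.
Unset Printing Implicit Defensive.

(** * C^k calculus *)

(** A pair (homeomorphism, scale) that preserves the law of [X_{y0}] can be applied before [f_y]
    without losing similarity, and scales multiply. One self-map for every positive scale, chosen in
    a C^k way, therefore suffices to absorb [c_y], and with all scales 1 the relation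
    [c (f y z) = c y * c z] is trivial. A value of [r_y] other than 1 leads to such self-maps
    because [r_y(y0) = 1]: it makes [r_y] non-constant.

    Two obstacles shape the rest. The Markov property gives equalities of integrals, hence an
    exceptional null set of states for each event; countable generation of events on
    right-continuous paths merges these sets, and a limit argument removes what is left. The local
    family [L] need not be a one-parameter group, so it cannot be extended by an additive law; the
    continuation interpolates between products with the same total scale. Regularity is carried by
    maps from normed spaces into [M] (plots), so that compositions replace computations in
    charts. *)

Section CkCalculus.
Context {R : realType}.

(* Coordinates on a finite-dimensional space, kept abstract so that [R], row
   vectors and their products are treated alike. *)
Record basis (V : normedModType R) := Basis {
  bdim : nat ;
  bvec : 'I_bdim -> V ;
  bcoord : 'I_bdim -> {linear V -> R^o} ;
  bcoord_continuous : forall i, continuous (bcoord i) ;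
  basisE : forall v, v = \sum_i bcoord i v *: bvec i }.

Lemma Ck_continuous (V W : normedModType R) k U (f : V -> W) :
  Ck k U f -> forall x, U x -> {for x, continuous f}.
Proof. by case: k => [|k] []. Qed.

Lemma Ck_derivable (V W : normedModType R) k U (f : V -> W) :
  Ck k.+1 U f -> forall x v, U x -> derivable f x v.
Proof. by case=> _ []. Qed.

Lemma Ck_derive (V W : normedModType R) k U (f : V -> W) v :
  Ck k.+1 U f -> Ck k U ('D_v f).
Proof. by case=> _ [_]; apply. Qed.

Lemma Ck_pred (V W : normedModType R) k U (f : V -> W) :
  Ck k.+1 U f -> Ck k U f.
Proof.
elim: k f => [|k IH] f fk; first by split=> //; apply: Ck_continuous fk.
split; first exact: Ck_continuous fk.
split; first exact: Ck_derivable fk.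
by move=> v; apply: IH; apply: Ck_derive.
Qed.

Lemma Ck_leq (V W : normedModType R) j k U (f : V -> W) :
  (j <= k)%N -> Ck k U f -> Ck j U f.
Proof.
move=> /subnKC <-; elim: (k - j)%N => [|i IH]; first by rewrite addn0.
by rewrite addnS => /Ck_pred.
Qed.

(** All clauses of [Ck] are conditions at single points of [U], imposed on [f] itself and not on a
    restriction. They can thus be tested on singletons, where the derivatives still see a whole
    neighbourhood of the point. *)
Lemma Ck_pointwise (V W : normedModType R) k U (f : V -> W) :
  Ck k U f <-> forall x, U x -> Ck k [set x] f.
Proof.
elim: k f => [|k IH] f /=.
  split=> [[fc _] x Ux|fU]; first by split=> // y ->; apply: fc.
  by split=> // x Ux; have [+ _] := fU x Ux; apply.
split=> [[fc [fd fD]] x Ux|fU].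
  split=> [y -> |]; first exact: fc.
  split=> [y v ->|v]; first exact: fd.
  by move/IH: (fD v); apply.
split=> [x Ux|]; first by have [+ _] := fU x Ux; apply.
split=> [x v Ux|v]; first by have [_ [+ _]] := fU x Ux; apply.
by apply/IH => x Ux; have [_ [_]] := fU x Ux; apply.
Qed.

Lemma Ck_subset (V W : normedModType R) k U U' (f : V -> W) :
  U' `<=` U -> Ck k U f -> Ck k U' f.
Proof. by move=> UU /Ck_pointwise fU; apply/Ck_pointwise => x /UU; apply: fU. Qed.

Lemma Ck_eq (V W : normedModType R) k U (f g : V -> W) :
  open U -> {in U, f =1 g} -> Ck k U f -> Ck k U g.
Proof.
move=> oU; elim: k f g => [|k IH] f g fg.
  case=> fc _; split=> // x Ux; rewrite /prop_for/continuous_at.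
  rewrite -(fg x (mem_set Ux)).
  apply: cvg_trans (fc x Ux); apply: near_eq_cvg.
  have: nbhs x U by apply: open_nbhs_nbhs.
  by apply: filterS => y Uy; rewrite fg ?inE.
have nfg x : U x -> \near x, f x = g x.
  move=> Ux; have : nbhs x U by apply: open_nbhs_nbhs.
  by apply: filterS => y Uy; rewrite fg ?inE.
move=> fk; split.
  move=> x Ux; rewrite /prop_for/continuous_at.
  rewrite -(fg x (mem_set Ux)).
  by apply: cvg_trans (Ck_continuous fk Ux); apply: near_eq_cvg; apply: nfg.
split=> [x v Ux|v].
  by move: (nfg x Ux) (Ck_derivable fk (v:=v) Ux); apply: near_eq_derivable.
apply: IH (Ck_derive v fk) => x /set_mem Ux.
exact: near_eq_derive (nfg x Ux).
Qed.

Lemma Ck_cst (V W : normedModType R) k U (w : W) : Ck k U (fun _ : V => w).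
Proof.
elim: k w => [|k IH] w; first by split=> // x _; exact: cvg_cst.
split; first by move=> x _; exact: cvg_cst.
split=> [x v _|v]; first exact: derivable_cst.
have -> : 'D_v (fun _ : V => w) = fun=> 0 by apply/funext => x; exact: derive_cst.
exact: IH.
Qed.

Lemma Ck_add (V W : normedModType R) k U (f g : V -> W) : open U ->
  Ck k U f -> Ck k U g -> Ck k U (fun x => f x + g x).
Proof.
move=> oU; elim: k f g => [|k IH] f g fk gk.
  by split=> // x Ux; apply: continuousD; [apply: Ck_continuous fk _ _|apply:
    Ck_continuous gk _ _].
split; first by move=> x Ux; apply: continuousD; [apply: Ck_continuous fk _ _|apply:
  Ck_continuous gk _ _].
have H x v (Ux : U x) := is_deriveD (derivableP (Ck_derivable fk (v:=v) Ux))
  (derivableP (Ck_derivable gk (v:=v) Ux)).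
split=> [x v Ux|v]; first by have [] := H x v Ux.
apply: Ck_eq (IH _ _ (Ck_derive v fk) (Ck_derive v gk)) => // x /set_mem Ux.
by have [_ ->] := H x v Ux.
Qed.

Lemma Ck_sum (V W : normedModType R) k U n (f : 'I_n -> V -> W) : open U ->
  (forall i, Ck k U (f i)) -> Ck k U (fun x => \sum_i f i x).
Proof.
move=> oU fk; elim: n f fk => [|n IH] f fk.
  apply: Ck_eq (Ck_cst k U (0 : W)) => // x _; by rewrite big_ord0.
apply: (@Ck_eq _ _ _ _ (fun x => \sum_(i < n) f (widen_ord (leqnSn n) i) x + f
  ord_max x)) => //.
  by move=> x _; rewrite big_ord_recr.
by apply: Ck_add => //; apply: IH.
Qed.

Lemma Ck_linear_comp (V W Z : normedModType R) k U (f : V -> W)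
    (L : {linear W -> Z}) : open U -> continuous L ->
  Ck k U f -> Ck k U (L \o f).
Proof.
move=> oU Lc; elim: k f => [|k IH] f fk.
  by split=> // x Ux; apply: continuous_comp; [apply: Ck_continuous fk _ _|exact: Lc].
split; first by move=> x Ux; apply: continuous_comp;
  [apply: Ck_continuous fk _ _|exact: Lc].
have H x v : U x -> is_derive x v (L \o f) (L ('D_v f x)).
  move=> Ux; have fd := Ck_derivable fk (v:=v) Ux.
  have cv : (fun h : R => h^-1 *: ((L \o f \o shift x) (h *: v) - (L \o f) x)) @ 0^'
    --> L ('D_v f x).
    have -> : (fun h : R => h^-1 *: ((L \o f \o shift x) (h *: v) - (L \o f) x)) =
              L \o (fun h : R => h^-1 *: ((f \o shift x) (h *: v) - f x)).
      by apply/funext => h /=; rewrite -linearB -linearZ.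
    by apply: cvg_comp fd _; exact: Lc.
  split; first by apply/cvg_ex; exists (L ('D_v f x)).
  exact: cvg_lim cv.
split=> [x v Ux|v]; first by have [] := H x v Ux.
apply: Ck_eq (IH _ (Ck_derive v fk)) => // x /set_mem Ux.
by have [_ ->] := H x v Ux.
Qed.

Lemma Ck_linear (V W : normedModType R) k U (L : {linear V -> W}) :
  open U -> continuous L -> Ck k U L.
Proof.
move=> oU Lc; case: k => [|k]; first by split=> // x _; exact: Lc.
have H x v : is_derive x v L (L v).
  split; first by apply: diff_derivable; apply: linear_differentiable.
  by rewrite deriveE ?diff_lin//; apply: linear_differentiable.
split; first by move=> x _; exact: Lc.
split=> [x v _|v]; first by have [] := H x v.
apply: Ck_eq (Ck_cst k U (L v)) => // x _; by have [_ ->] := H x v.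
Qed.

Lemma Ck_mul (V : normedModType R) k U (f g : V -> R) : open U ->
  Ck k U f -> Ck k U g -> Ck k U (fun x => f x * g x).
Proof.
move=> oU; elim: k f g => [|k IH] f g fk gk.
  by split=> // x Ux; apply: continuousM; [apply: Ck_continuous fk _ _|apply:
    Ck_continuous gk _ _].
split; first by move=> x Ux; apply: continuousM; [apply: Ck_continuous fk _ _|apply:
  Ck_continuous gk _ _].
have H x v (Ux : U x) := is_deriveM (derivableP (Ck_derivable fk (v:=v) Ux))
  (derivableP (Ck_derivable gk (v:=v) Ux)).
split=> [x v Ux|v]; first by have [] := H x v Ux.
apply: (@Ck_eq _ _ _ _ (fun x => f x * 'D_v g x + g x * 'D_v f x)) => //.
  by move=> x /set_mem Ux; have [_ ->] := H x v Ux.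
by apply: Ck_add => //; apply: IH; rewrite //; [exact: Ck_pred|exact:
  Ck_derive|exact: Ck_pred|exact: Ck_derive].
Qed.

End CkCalculus.
Arguments bvec {R V} b i.
Arguments bcoord {R V} b i.
Arguments bcoord_continuous {R V} b i.
Arguments basisE {R V} b v.

(** * Differentiability from continuous partial derivatives, and the chain rule *)

Section ChainRule.
Context {R : realType}.

Lemma continuous_sum (V W : normedModType R) n (f : 'I_n -> V -> W) :
  (forall i, continuous (f i)) -> continuous (fun x => \sum_i f i x).
Proof.
move=> fc x; have f0 i : Ck 0 setT (f i) by split=> // y _; apply: fc.
by have [+ _] := Ck_sum openT f0; apply.
Qed.

Lemma is_derive_line (V W : normedModType R) (f : V -> W) (x v : V) (s : R) d :
  is_derive (s *: v + x) v f d <->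
  is_derive s 1 (fun h : R => f (h *: v + x)) d.
Proof.
have E : (fun h : R => h^-1 *: ((f \o shift (s *: v + x)) (h *: v) - f (s *: v + x))) =
  (fun h : R => h^-1 *: (((fun h : R => f (h *: v + x)) \o shift s) (h *: (1:R)) - f
    (s *: v + x))).
  by apply/funext => h /=; rewrite addrA -scalerDl [h *: 1]mulr1.
by split=> -[fd fD]; split; rewrite /derivable /derive ?E// -?E.
Qed.

(** The hypothesis is in absolute values because [t] may have either sign. With [c] a derivative at
    a nearby point the bound is a uniform first-order expansion; with [c = eps = 0] it is constancy
    along a segment. *)
Lemma mean_value_line (V : normedModType R) (f : V -> R) (y e : V) (t c eps : R) :
  (forall s : R, `|s| <= `|t| -> derivable f (s *: e + y) e /\
     `|'D_e f (s *: e + y) - c| <= eps) ->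
  `|f (t *: e + y) - f y - t * c| <= eps * `|t|.
Proof.
move=> fs.
pose g (s : R) := f (s *: e + y).
have gd (s : R) : `|s| <= `|t| -> is_derive s 1 g ('D_e f (s *: e + y)).
  move=> /fs[fd _]; apply: (iffLR (@is_derive_line V _ f y e s _)).
    exact: derivableP.
have gc (a b : R) : (forall s : R, s \in `[a, b] -> `|s| <= `|t|) -> {within `[a, b],
  continuous g}.
  move=> ab; apply: derivable_within_continuous => s /ab sab.
  by have [] := gd _ sab.
have [s [st gs]] : exists s : R, `|s| <= `|t| /\ g t - g 0 = 'D_e f (s *: e + y) * (t - 0).
  have [t0|t0] := leP 0 t.
    have tt (s : R) : s \in `[0, t] -> `|s| <= `|t|.
      by rewrite in_itv/= => /andP[s0 st]; rewrite !ger0_norm.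
    have [|c' c't E] := @MVT_segment R g (fun s => 'D_e f (s *: e + y)) 0 t t0 _ (gc
      _ _ tt).
      by move=> s /subset_itv_oo_cc st; apply: gd; apply: tt.
    by exists c'; split=> //; apply: tt.
  have tt (s : R) : s \in `[t, 0] -> `|s| <= `|t|.
    by rewrite in_itv/= => /andP[s0 st]; rewrite !ler0_norm ?lerN2// ltW.
  have [|c' c't E] := @MVT_segment R g (fun s => 'D_e f (s *: e + y)) t 0 (ltW t0) _
    (gc _ _ tt).
    by move=> s /subset_itv_oo_cc st; apply: gd; apply: tt.
  exists c'; split=> //; first exact: tt.
  by rewrite -opprB E -mulrN opprB.
have -> : f (t *: e + y) - f y - t * c = ('D_e f (s *: e + y) - c) * t.
  have := gs; rewrite /g scale0r add0r => ->; rewrite subr0; ring.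
by rewrite normrM ler_wpM2r//; have [_] := fs _ st.
Qed.

(** The base point [y] varies near [x] because coordinates are later changed one at a time, each
    change starting from a point already moved by the others. *)
Lemma partial_increment (V : normedModType R) U (f : V -> R) (x e : V) (eps : R) :
  open U -> Ck 1 U f -> U x -> 0 < eps ->
  exists2 d : R, 0 < d & forall y t, `|y - x| < d -> `|t| < d ->
    `|f (t *: e + y) - f y - t * 'D_e f x| <= eps * `|t|.
Proof.
move=> oU fk Ux eps0.
have : \forall z \near x, U z /\ `|'D_e f z - 'D_e f x| <= eps.
  apply: filterI; first exact: open_nbhs_nbhs.
  have /cvgrPdist_le/(_ eps eps0) := Ck_continuous (Ck_derive e fk) Ux.
  by apply: filterS => z; rewrite distrC.
move=> /nbhs_ballP[r /= r0 rU].
(* Half of the radius [r] is reserved for [y - x] and half for [s *: e]; the added 1 covers the case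
   [e = 0]. *)
pose d := Num.min (r / 2) (r / 2 / (`|e| + 1)).
have e1 : 0 < `|e| + 1 by rewrite ltr_pwDr.
exists d; first by rewrite lt_min !divr_gt0.
move=> y t yx td; apply: mean_value_line => s st.
have /rU[Uz zeps] : ball x r (s *: e + y).
  rewrite -ball_normE /= opprD addrCA -opprB addrC.
  rewrite (le_lt_trans (ler_normB _ _))//.
  have h1 : `|y - x| < r / 2 by apply: lt_le_trans yx _; rewrite ge_min lexx.
  have h2 : `|s *: e| <= r / 2.
    rewrite normrZ; have : `|s| < r / 2 / (`|e| + 1).
      by apply: le_lt_trans st (lt_le_trans td _); rewrite ge_min lexx orbT.
    rewrite ltr_pdivlMr// => h; apply: le_trans (ltW h); rewrite ler_wpM2l//.
    by rewrite lerDl.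
  by rewrite normrN; lra.
split=> //; exact: Ck_derivable fk _ _ Uz.
Qed.

(** A telescoping sum: the last direction is treated by [partial_increment] from the point moved
    along the first [n], whose increment is known by induction. The Lipschitz bound on the last
    linear form turns its error into a multiple of the norm of [h]. *)
Lemma partials_increment (V : normedModType R) U (f : V -> R) (x : V) n
    (e : 'I_n -> V) (a : 'I_n -> {linear V -> R^o}) :
  open U -> Ck 1 U f -> U x -> (forall i, continuous (a i)) ->
  forall eps : R, 0 < eps -> \forall h \near (0 : V),
    `|f (\sum_i a i h *: e i + x) - f x - \sum_i a i h * 'D_(e i) f x| <= eps * `|h|.
Proof.
move=> oU fk Ux; elim: n e a => [|n IH] e a ac eps eps0.
  apply: nearW => h; rewrite !big_ord0 add0r subrr subr0 normr0.
  by rewrite mulr_ge0// ltW.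
have [K K0 aK] := linear_lipschitz (ac ord_max).
have [|d d0 fd] := @partial_increment V U f x (e ord_max) (eps / 2 / K) oU fk Ux.
  by rewrite !divr_gt0.
have {}IH := IH (e \o widen_ord (leqnSn n)) (a \o widen_ord (leqnSn n)) (fun i =>
  ac _) (eps / 2).
have e2 : 0 < eps / 2 by rewrite divr_gt0.
have sc : continuous (fun h => \sum_(i < n) a (widen_ord (leqnSn n) i) h *: e
  (widen_ord (leqnSn n) i)).
  by apply: continuous_sum => i h; apply: cvgZr_tmp; exact: ac.
have ns : \forall h \near (0 : V), `|\sum_(i < n) a (widen_ord (leqnSn n) i) h *: e
  (widen_ord (leqnSn n) i)| < d.
  have /cvgr_norm_lt := sc 0; apply.
  by rewrite big1 ?normr0// => i _; rewrite linear0 scale0r.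
have na : \forall h \near (0 : V), `|a ord_max h| < d.
  have /cvgr_norm_lt := ac ord_max 0; apply.
  by rewrite linear0 normr0.
have nI := IH e2.
near=> h.
rewrite !big_ord_recr /=; set S := \sum_(i < n) _ *: _.
have H1 : `|f (S + x) - f x - \sum_(i < n) a (widen_ord (leqnSn n) i) h * 'D_(e
  (widen_ord (leqnSn n) i)) f x| <= eps / 2 * `|h|.
  exact: (near nI h).
have Sd : `|(S + x) - x| < d by rewrite addrK; exact: (near ns h).
have td : `|a ord_max h| < d by exact: (near na h).
have H2 := fd _ _ Sd td.
have H3 : eps / 2 / K * `|a ord_max h| <= eps / 2 * `|h|.
  rewrite -mulrA ler_wpM2l ?(ltW e2)// ler_pdivrMl//; exact: aK.
rewrite [S + _]addrC -[_ + S + x]addrA; set z := f (_ + (S + x)) in H2 *.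
set s := \sum_(i < n) _ * _ in H1 *.
have -> : z - f x - (s + a ord_max h * 'D_(e ord_max) f x) =
  (f (S + x) - f x - s) + (z - f (S + x) - a ord_max h * 'D_(e ord_max) f x) by ring.
rewrite (le_trans (ler_normD _ _))//; have := le_trans H2 H3; lra.
Unshelve. all: by end_near. Qed.

(** [df] is the only candidate for the differential, and [partials_increment], applied to the
    expansion of [h] in the basis, is the little-o estimate for it. *)
Lemma C1_differentiable (V : normedModType R) (b : basis V) U (f : V -> R) x :
  open U -> Ck 1 U f -> U x -> differentiable f x.
Proof.
move=> oU fk Ux.
pose df (h : V) : R := \sum_i bcoord b i h * 'D_(bvec b i) f x.
have lin : linear (df : V -> R^o).
  move=> k u v; rewrite /df scaler_sumr -big_split/=; apply: eq_bigr => i _.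
  by rewrite linearP mulrDl scalerAl.
pose dfl : {linear V -> R^o} := HB.pack (df : V -> R^o) (GRing.isLinear.Build _ _ _ _
  (df : V -> R^o) lin).
have dfc : continuous dfl.
  apply: (@continuous_sum V R _ (fun i h => bcoord b i h * 'D_(bvec b i) f x)) => i h.
  by apply: cvgMr_tmp; exact: bcoord_continuous.
have E : f \o shift x = cst (f x) + dfl +o_ (0 : V) id.
  apply/eqaddoP => eps eps0.
  have := partials_increment (bvec b) oU fk Ux (bcoord_continuous b) eps0.
  apply: filterS => h /=; rewrite -basisE /dfl/= /df.
  by rewrite !fctE /= opprD addrA.
by apply/diff_locallyP; rewrite (diff_unique dfc E).
Qed.

Lemma is_derive_comp (V W : normedModType R) (f : V -> W) (g : W -> R) (x v : V) :
  derivable f x v -> differentiable g (f x) ->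
  is_derive x v (g \o f) ('d g (f x) ('D_v f x)).
Proof.
move=> fd gd.
have E : x = 0 *: v + x by rewrite scale0r add0r.
have : is_derive (0 *: v + x) v f ('D_v f x) by rewrite -E; apply: derivableP.
move=> /(iffLR (@is_derive_line V W f x v 0 _)) [/derivable1_diffP phid phiD].
rewrite {1}E; apply: (iffRL (@is_derive_line V _ (g \o f) x v 0 _)).
have gphi : differentiable g ((fun h : R => f (h *: v + x)) 0) by rewrite -E.
have := differentiable_comp phid gphi.
move=> gphid; split; first exact/derivable1_diffP.
rewrite (deriveE _ gphid) (diff_comp phid gphi) /= -(deriveE _ phid) phiD.
by rewrite -E.
Qed.

Lemma C1_derive (V : normedModType R) (b : basis V) U (f : V -> R) x v :
  open U -> Ck 1 U f -> U x ->
  'd f x v = \sum_i bcoord b i v * 'D_(bvec b i) f x.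
Proof.
move=> oU fk Ux; have fd := C1_differentiable b oU fk Ux.
rewrite {1}(basisE b v) linear_sum; apply: eq_bigr => i _.
by rewrite linearZ (deriveE _ fd).
Qed.

Lemma Ck_coord (V W : normedModType R) (b : basis W) k U (f : V -> W) :
  open U -> (forall i, Ck k U (bcoord b i \o f)) -> Ck k U f.
Proof.
move=> oU fi.
apply: (@Ck_eq _ _ _ _ _ (fun x => \sum_i (bcoord b i (f x)) *: bvec b i)) => //.
  by move=> x _; rewrite -basisE.
apply: Ck_sum => // i.
have lin : linear (fun r : R^o => r *: bvec b i).
  by move=> k' u v; rewrite scalerDl scalerA.
pose L : {linear R^o -> W} := HB.pack (fun r : R^o =>
  r *: bvec b i) (GRing.isLinear.Build _ _ _ _ _ lin).
apply: (@Ck_linear_comp _ _ _ _ _ _ (bcoord b i \o f) L) => //.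
by move=> h; apply: cvgZr_tmp; exact: cvg_id.
Qed.

(** After reduction to scalar values through the coordinates of [Z], the derivative of [g \o f] is a
    finite sum of products in which partial derivatives of [g] are composed with [f]. These lose one
    order, which is what the induction on [k] allows. *)
Lemma Ck_comp (V W Z : normedModType R) (bW : basis W) (bZ : basis Z) k U U'
    (f : V -> W) (g : W -> Z) :
  open U -> open U' -> (forall x, U x -> U' (f x)) ->
  Ck k U f -> Ck k U' g -> Ck k U (g \o f).
Proof.
move=> oU oU' UU' fk gk; apply: (Ck_coord (b := bZ)) => // j.
have {gk} : Ck k U' (bcoord bZ j \o g).
  by apply: Ck_linear_comp => //; exact: bcoord_continuous.
have -> : bcoord bZ j \o (g \o f) = (bcoord bZ j \o g) \o f by [].
move: (bcoord bZ j \o g) => {}g; elim: k f g fk UU' => [|k IH] f g fk UU' gk.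
  split=> // x Ux; apply: continuous_comp; first exact: Ck_continuous fk _ _.
  by apply: Ck_continuous gk _ _; exact: UU'.
have H x v : U x -> is_derive x v (g \o f)
    (\sum_i bcoord bW i ('D_v f x) * 'D_(bvec bW i) g (f x)).
  move=> Ux; have g1 : Ck 1 U' g by apply: Ck_leq gk.
  rewrite -(C1_derive _ _ oU' g1 (UU' _ Ux)); apply: is_derive_comp.
    exact: Ck_derivable fk _ _ Ux.
  exact: C1_differentiable oU' g1 (UU' _ Ux).
split.
  move=> x Ux; apply: continuous_comp; first exact: Ck_continuous fk _ _.
  by apply: Ck_continuous gk _ _; exact: UU'.
split=> [x v Ux|v]; first by have [] := H x v Ux.
apply: (@Ck_eq _ _ _ _ _ (fun x => \sum_i bcoord bW i ('D_v f x) * 'D_(bvec bW i) g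
  (f x))) => //.
  by move=> x /set_mem Ux; have [_ ->] := H x v Ux.
apply: Ck_sum => // i; apply: Ck_mul => //.
  apply: (@Ck_linear_comp _ _ _ _ _ _ ('D_v f) (bcoord bW i)) => //;
    first exact: bcoord_continuous.
  exact: Ck_derive.
apply: (IH f ('D_(bvec bW i) g)) => //; first exact: Ck_pred.
exact: Ck_derive.
Qed.

End ChainRule.

Section Bases.
Context {R : realType}.

Definition basis_scalar : basis R^o.
Proof.
apply: (@Basis R R^o 1 (fun=> 1) (fun=> idfun)) => [i x|v]; first exact: cvg_id.
by rewrite big_ord1 /= [_ *: _]mulr1.
Defined.

Definition basis_row n : basis 'rV[R]_n.
Proof.
have lin (i : 'I_n) : linear (fun v : 'rV[R]_n => v 0 i : R^o).
  by move=> a u v; rewrite !mxE.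
apply: (@Basis R 'rV[R]_n n (delta_mx 0)
  (fun i => HB.pack (fun v : 'rV[R]_n => v 0 i : R^o) (GRing.isLinear.Build _ _ _ _ _
    (lin i)))) => [i|v].
  exact: matrix_normedtype.coord_continuous.
exact: row_sum_delta.
Defined.

Lemma fst_linear (V W : normedModType R) : linear (fst : V * W -> V).
Proof. by []. Qed.

Lemma snd_linear (V W : normedModType R) : linear (snd : V * W -> W).
Proof. by []. Qed.

Lemma inl_linear (V W : normedModType R) : linear (fun v : V => (v, 0) : V * W).
Proof. by move=> a u v; congr pair; rewrite /= scaler0 addr0. Qed.

Lemma inr_linear (V W : normedModType R) : linear (fun w : W => (0, w) : V * W).
Proof. by move=> a u v; congr pair; rewrite /= scaler0 addr0. Qed.

Definition fst_lin (V W : normedModType R) : {linear (V * W)%type -> V} :=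
  HB.pack (fst : V * W -> V) (GRing.isLinear.Build _ _ _ _ _ (@fst_linear V W)).
Definition snd_lin (V W : normedModType R) : {linear (V * W)%type -> W} :=
  HB.pack (snd : V * W -> W) (GRing.isLinear.Build _ _ _ _ _ (@snd_linear V W)).
Definition inl_lin (V W : normedModType R) : {linear V -> (V * W)%type} :=
  HB.pack (fun v : V => (v, 0) : V * W) (GRing.isLinear.Build _ _ _ _ _ (@inl_linear V W)).
Definition inr_lin (V W : normedModType R) : {linear W -> (V * W)%type} :=
  HB.pack (fun w : W => (0, w) : V * W) (GRing.isLinear.Build _ _ _ _ _ (@inr_linear V W)).

Definition basis_prod (V W : normedModType R) (bV : basis V) (bW : basis W) :
  basis (V * W)%type.
Proof.
pose n := bdim bV; pose m := bdim bW.
pose bv (i : 'I_(n + m)) : (V * W)%type :=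
  match fintype.split i with inl j => (bvec bV j, 0) | inr j => (0, bvec bW j) end.
pose bc (i : 'I_(n + m)) : {linear (V * W)%type -> R^o} :=
  match fintype.split i with inl j => bcoord bV j \o fst_lin V W
                   | inr j => bcoord bW j \o snd_lin V W end.
refine (@Basis R (V * W)%type (n + m) bv bc _ _).
  move=> i; rewrite /bc; case: fintype.split => j v; (apply: continuous_comp;
    last exact: bcoord_continuous).
    exact: cvg_fst.
  exact: cvg_snd.
move=> [v w]; rewrite /bv /bc big_split_ord /=.
under eq_bigr => i _ do rewrite (unsplitK (inl i)) /=.
under [X in _ + X]eq_bigr => i _ do rewrite (unsplitK (inr i)) /=.
rewrite -[in LHS](addr0 v) -[in LHS](add0r w).
have -> : (v + 0, 0 + w) = (v, 0) + (0, w) :> V * W by [].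
congr (_ + _).
  transitivity (inl_lin V W (\sum_i bcoord bV i v *: bvec bV i)).
    by rewrite -basisE.
  by rewrite linear_sum; apply: eq_bigr => i _; rewrite linearZ.
transitivity (inr_lin V W (\sum_i bcoord bW i w *: bvec bW i)).
  by rewrite -basisE.
by rewrite linear_sum; apply: eq_bigr => i _; rewrite linearZ.
Defined.

End Bases.

(** * C^k regularity near a point *)

Section CkNear.
Context {R : realType}.

Definition Ck_near (V W : normedModType R) k (f : V -> W) (x : V) :=
  nbhs x [set y | Ck k [set y] f].

Lemma Ck_nearP (V W : normedModType R) k (f : V -> W) x :
  Ck_near k f x <-> exists U, [/\ open U, U x & Ck k U f].
Proof.
split.
  rewrite /Ck_near nbhsE => -[U [oU Ux] Uf]; exists U; split=> //.
  exact/Ck_pointwise.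
move=> [U [oU Ux /Ck_pointwise Uf]].
by have : nbhs x U by [apply: open_nbhs_nbhs]; apply: filterS.
Qed.

Lemma Ck_near_continuous (V W : normedModType R) k (f : V -> W) x :
  Ck_near k f x -> {for x, continuous f}.
Proof. by move=> /nbhs_singleton /Ck_continuous; apply. Qed.

Lemma Ck_near_nbhs (V W : normedModType R) k (f : V -> W) x :
  Ck_near k f x -> \forall y \near x, Ck_near k f y.
Proof. by move=> /nbhs_interior. Qed.

Lemma Ck_near_eq (V W : normedModType R) k (f g : V -> W) x :
  (\near x, f x = g x) -> Ck_near k f x -> Ck_near k g x.
Proof.
move=> fg /(filterI fg); rewrite nbhsE => -[U [oU Ux] Uf].
apply/Ck_nearP; exists U; split => //.
apply: (Ck_eq (f := f)) => //; first by move=> y /set_mem /Uf[].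
by apply/Ck_pointwise => y /Uf[].
Qed.

Lemma Ck_near_comp (V W Z : normedModType R) (bW : basis W) (bZ : basis Z) k
    (f : V -> W) (g : W -> Z) x :
  Ck_near k f x -> Ck_near k g (f x) -> Ck_near k (g \o f) x.
Proof.
move=> fx; have fc := Ck_near_continuous fx.
move: fx => /Ck_nearP [U [oU Ux fU]] /Ck_nearP [U' [oU' Ux' gU']].
apply/Ck_nearP; exists ((U `&` f @^-1` U')°); split.
- exact: open_interior.
- apply: filterI; first exact: open_nbhs_nbhs.
  by apply: fc; apply: open_nbhs_nbhs.
- apply: (Ck_comp bW bZ (U' := U')) => //; first exact: open_interior.
    by move=> y /interior_subset [].
  by apply: Ck_subset fU => y /interior_subset [].
Qed.

Lemma Ck_near_op2 (V W W' Z : normedModType R) k (f : V -> W) (g : V -> W') (h : V -> Z) x :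
  (forall U, open U -> Ck k U f -> Ck k U g -> Ck k U h) ->
  Ck_near k f x -> Ck_near k g x -> Ck_near k h x.
Proof.
move=> H /Ck_nearP[U [oU Ux fU]] /Ck_nearP[U' [oU' Ux' gU]].
apply/Ck_nearP; exists (U `&` U'); split=> //; first exact: openI.
apply: H; first exact: openI.
  by apply: Ck_subset fU => y [].
by apply: Ck_subset gU => y [].
Qed.

Lemma Ck_near_add (V W : normedModType R) k (f g : V -> W) x :
  Ck_near k f x -> Ck_near k g x -> Ck_near k (fun x => f x + g x) x.
Proof. by apply: Ck_near_op2 => U; apply: Ck_add. Qed.

Lemma Ck_near_mul (V : normedModType R) k (f g : V -> R) x :
  Ck_near k f x -> Ck_near k g x -> Ck_near k (fun x => f x * g x) x.
Proof. by apply: Ck_near_op2 => U; apply: Ck_mul. Qed.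

Lemma Ck_near_pair (V W Z : normedModType R) (bW : basis W) (bZ : basis Z) k
    (f : V -> W) (g : V -> Z) x :
  Ck_near k f x -> Ck_near k g x -> Ck_near k (fun x => (f x, g x)) x.
Proof.
apply: Ck_near_op2 => U oU fU gU; apply: (Ck_coord (b := basis_prod bW bZ)) => // i.
rewrite /= ; case: fintype.split => j.
  exact: (Ck_linear_comp (f := f) (L := bcoord bW j) oU (bcoord_continuous _ _)).
exact: (Ck_linear_comp (f := g) (L := bcoord bZ j) oU (bcoord_continuous _ _)).
Qed.

Lemma Ck_near_cst (V W : normedModType R) k (w : W) x : Ck_near k (fun _ : V => w) x.
Proof. by apply/Ck_nearP; exists setT; split=> //; [exact: openT|exact: Ck_cst]. Qed.

Lemma Ck_near_linear (V W : normedModType R) k (L : {linear V -> W}) x :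
  continuous L -> Ck_near k L x.
Proof.
by move=> Lc; apply/Ck_nearP; exists setT; split=> //;
  [exact: openT|apply: Ck_linear => //; exact: openT].
Qed.

Lemma Ck_near_id (V : normedModType R) k x : Ck_near k (@id V) x.
Proof. by apply: (@Ck_near_linear _ _ _ idfun) => y; exact: cvg_id. Qed.

Lemma Ck_near_fst (V W : normedModType R) k x : Ck_near k (fst : V * W -> V) x.
Proof. by apply: (@Ck_near_linear _ _ _ (fst_lin V W)) => y; exact: cvg_fst. Qed.

Lemma Ck_near_snd (V W : normedModType R) k x : Ck_near k (snd : V * W -> W) x.
Proof. by apply: (@Ck_near_linear _ _ _ (snd_lin V W)) => y; exact: cvg_snd. Qed.

Lemma Ck_near_scale (V W : normedModType R) (bW : basis W) k (f : V -> R) (w : W) x :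
  Ck_near k f x -> Ck_near k (fun x => f x *: w) x.
Proof.
move=> fk.
have lin : linear (fun r : R^o => r *: w).
  by move=> a u v; rewrite scalerDl scalerA.
pose L : {linear R^o -> W} := HB.pack (fun r : R^o =>
  r *: w) (GRing.isLinear.Build _ _ _ _ _ lin).
apply: (Ck_near_comp basis_scalar bW (f := f : V -> R^o) (g := L)) => //.
by apply: Ck_near_linear => y; apply: cvgZr_tmp; exact: cvg_id.
Qed.

End CkNear.

(** * Functions of one real variable: transition functions and local inverses *)

Section RealFunctions.
Context {R : realType}.

Lemma Ck_derive1 k (U : set R) (f df : R -> R) : open U ->
  (forall x, U x -> is_derive x 1 f (df x)) -> Ck k U df -> Ck k.+1 U f.
Proof.
move=> oU fd dfk.
have fdiff x : U x -> differentiable f x.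
  by move=> /fd[fx _]; apply/derivable1_diffP.
split; first by move=> x /fdiff; apply: differentiable_continuous.
split=> [x v /fdiff|v]; first exact: diff_derivable.
apply: (Ck_eq (f := fun x => v * df x)) => // [x /set_mem Ux|].
  rewrite (deriveE _ (fdiff _ Ux)) -[in RHS](mulr1 v) -[_ * 1]/(v *: (1 : R)) linearZ.
  by have [_ <-] := fd _ Ux; rewrite (deriveE _ (fdiff _ Ux)).
by apply: Ck_mul => //; exact: Ck_cst.
Qed.

Lemma Ck_inv k : Ck k [set x : R | x != 0] GRing.inv.
Proof.
have oU : open [set x : R | x != 0] by exact: open_neq.
elim: k => [|k IH]; first by split=> // x x0; apply: inv_continuous.
apply: (@Ck_derive1 _ _ _ (fun x => (-1) * (x^-1 * x^-1))) => // [x x0|].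
  have -> : (-1) * (x^-1 * x^-1) = - x ^- 2 *: (1 : R).
    by rewrite /GRing.scale/= mulr1 mulN1r -expr2 exprVn.
  by apply: is_deriveV.
by apply: Ck_mul => //; [exact: Ck_cst|apply: Ck_mul].
Qed.

Lemma Ck_near_inv (V : normedModType R) k (f : V -> R) x : f x != 0 ->
  Ck_near k f x -> Ck_near k (fun x => (f x)^-1) x.
Proof.
move=> fx fk; apply: (Ck_near_comp basis_scalar basis_scalar (f := f) (g := GRing.inv
  : R^o -> R^o)) => //.
apply/Ck_nearP; exists [set x : R | x != 0]; split=> //; last exact: Ck_inv.
Qed.

Lemma Ck_near_ln (V : normedModType R) k (f : V -> R) x : 0 < f x ->
  Ck_near k f x -> Ck_near k (fun x => ln (f x)) x.
Proof.
move=> fx fk; apply: (Ck_near_comp basis_scalar basis_scalar (f := f) (g := @ln R :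
  R^o -> R^o)) => //.
have oU : open [set x : R | 0 < x] by exact: open_gt.
apply/Ck_nearP; exists [set x : R | 0 < x]; split=> //.
case: k {fk} => [|k]; first by split=> // y /= y0; exact: continuous_ln.
have lnd (y : R) : [set x : R | 0 < x] y -> is_derive y 1 (@ln R) y^-1.
  exact: is_derive1_ln.
apply: (Ck_derive1 oU lnd).
by apply: Ck_subset (Ck_inv k) => y /= y0; rewrite gt_eqF.
Qed.

(** Differentiating a power of the positive part lowers the exponent by one, so the order of
    regularity follows the exponent; only the derivative at 0 has to be computed by hand. *)
Lemma Ck_maxX k : Ck k setT (fun x : R => Num.max x 0 ^+ k.+1).
Proof.
elim: k => [|k IH].
  split=> // x _; rewrite /prop_for/continuous_at/=.
  by apply: (@continuous_max _ _ (@id R) (fun=> 0)); [exact: cvg_id|exact: cvg_cst].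
apply: (@Ck_derive1 _ _ _ (fun x => k.+2%:R * Num.max x 0 ^+ k.+1)); first exact: openT.
  move=> x _; have [x0|x0|->] := ltgtP x 0.
  - rewrite expr0n/= mulr0.
    have nE : \near x, cst 0 x = Num.max x 0 ^+ k.+2.
      have : \forall y \near x, y < 0 by apply: lt_nbhsl.
      by apply: filterS => y /ltW y0; rewrite /cst max_r// expr0n.
    by apply: near_eq_is_derive nE _; exact: is_derive_cst.
  - have nE : \near x, x ^+ k.+2 = Num.max x 0 ^+ k.+2.
      have : \forall y \near x, 0 < y by apply: lt_nbhsr.
      by apply: filterS => y /ltW y0; rewrite max_l.
    apply: near_eq_is_derive nE _.
    split; first exact: exprn_derivable.
    by rewrite -derive1E exp_derive1.
  (* At 0 the difference quotient is exactly [Num.max h 0 ^+ k.+1] for every non-zero [h] of either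
     sign, so its limit is the value of a continuous function. *)
  - have cv : (fun h : R => h^-1 *: (((fun x : R =>
    Num.max x 0 ^+ k.+2) \o shift 0) (h *: (1 : R)) - Num.max (0:R) 0 ^+ k.+2)) @ 0^'
    --> (Num.max 0 0 : R) ^+ k.+1.
      have c0 : (fun x : R => Num.max x 0 ^+ k.+1) x @[x --> 0^'] --> (Num.max 0 0 :
        R) ^+ k.+1.
        by apply: cvg_trans (Ck_continuous IH (x := 0) I); apply: cvg_app;
          exact: nbhs_dnbhs.
      apply: cvg_trans c0; apply: near_eq_cvg; near=> h.
      have h0 : h != 0 by near: h; exact: nbhs_dnbhs_neq.
      rewrite /= addr0 [h *: 1]mulr1 maxxx [0 ^+ k.+2]expr0n/= subr0.
      rewrite [Num.max h 0 ^+ k.+2]exprS /GRing.scale /= mulrA.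
      have [hn|hp|hE] := ltgtP h 0; first by rewrite !expr0n/= mulr0.
        by rewrite mulVf ?mul1r.
      by rewrite hE eqxx in h0.
    rewrite [in X in _ --> X]maxxx [in X in _ --> X]expr0n /= in cv;
      rewrite expr0n /= mulr0.
    by split; [apply/cvg_ex; exists 0|exact: cvg_lim cv].
by apply: Ck_mul => //; [exact: openT|exact: Ck_cst].
Unshelve. all: by end_near. Qed.

(** A transition from 0 to 1 of class C^k, built from two truncated powers. The factor 2 and the
    shift by 1/2 place its ends at 1/4 and 3/4; it is exactly constant beyond them, which makes
    pieces fit together at integers. *)
Definition step k (x : R) :=
  1 - Num.max (1 - Num.max (2 * x - 2^-1) 0 ^+ k.+1) 0 ^+ k.+1.

Lemma step0 k x : x <= 4^-1 -> step k x = 0.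
Proof.
move=> x4; rewrite /step [Num.max (2 * x - _) _]max_r ?expr0n/=; last by lra.
by rewrite subr0 max_l ?expr1n ?subrr.
Qed.

Lemma step1 k x : 3 / 4 <= x -> step k x = 1.
Proof.
move=> x4; rewrite /step [Num.max (2 * x - _) _]max_l; last by lra.
rewrite max_r ?expr0n ?subr0//= subr_le0 exprn_ege1//; lra.
Qed.

Lemma step_itv k x : 0 <= step k x <= 1.
Proof.
rewrite /step; have h (y : R) : y <= 1 -> 0 <= Num.max y 0 ^+ k.+1 <= 1.
  by move=> y1; rewrite exprn_ge0 ?exprn_ile1 ?le_max ?lexx ?orbT// ge_max y1 ler01.
have := h (1 - Num.max (2 * x - 2^-1) 0 ^+ k.+1).
rewrite gerBl exprn_ge0 ?le_max ?lexx ?orbT// => /(_ isT) /andP[h0 h1].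
by rewrite subr_ge0 h1 gerBl h0.
Qed.

Lemma Ck_near_step k (V : normedModType R) (f : V -> R) x :
  Ck_near k f x -> Ck_near k (step k \o f) x.
Proof.
move=> fk.
have mk (g : V -> R) : Ck_near k g x -> Ck_near k (fun x => Num.max (g x) 0 ^+ k.+1) x.
  move=> gk; apply: (Ck_near_comp basis_scalar basis_scalar (f := g) (g := fun x : R
    => Num.max x 0 ^+ k.+1)) => //.
  by apply/Ck_nearP; exists setT; split=> //; [exact: openT|exact: Ck_maxX].
have sk (c d : R) (g : V -> R) : Ck_near k g x -> Ck_near k (fun x => c + d * g x) x.
  by move=> gk; apply: Ck_near_add; [exact: Ck_near_cst|apply: Ck_near_mul => //;
    exact: Ck_near_cst].
have -> : step k \o f = fun x => 1 + (-1) * Num.max (1 + (-1) * Num.max (- 2^-1 + 2 *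
  f x) 0 ^+ k.+1) 0 ^+ k.+1.
  by apply/funext => y; rewrite /step /= !mulN1r [- 2^-1 + _]addrC.
by apply: (sk); apply: (mk); apply: (sk); apply: (mk); apply: (sk).
Qed.

(** By the mean value theorem a non-vanishing derivative makes [f] injective on a small ball. The
    formula [g' = 1 / (f' o g)] then raises the regularity of the inverse one order at a time. *)
Lemma local_inverse k (f : R -> R) x0 : Ck_near k.+1 f x0 -> 'D_1 f x0 != 0 ->
  exists g : R -> R, [/\ g (f x0) = x0, (\forall y \near f x0, f (g y) = y) &
    Ck_near k.+1 g (f x0)].
Proof.
move=> /Ck_nearP[U [oU Ux fU]] d0.
have fD : Ck k U ('D_1 f) by exact: Ck_derive.
have : nbhs x0 (U `&` [set x | 'D_1 f x != 0]).
  apply: filterI; first exact: open_nbhs_nbhs.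
  apply: (Ck_continuous fD Ux (t := [set y : R | y != 0])).
  by apply: open_nbhs_nbhs; split; [exact: open_neq|].
move=> /nbhs_ballP[r /= r0 rU].
have fd x : ball x0 r x -> is_derive x 1 f ('D_1 f x).
  by move=> /rU[Uy _]; apply: derivableP; exact: Ck_derivable fU _ _ Uy.
have fc x : ball x0 r x -> {for x, continuous f}.
  by move=> /rU[Uy _]; exact: Ck_continuous fU _ Uy.
have inj x y : ball x0 r x -> ball x0 r y -> x < y -> f x <> f y.
  move=> bx bY xy fxy.
  have bxy z : z \in `[x, y] -> ball x0 r z.
    move: bx bY; rewrite -!ball_normE /= in_itv/= !ltr_distlC.
    by move=> /andP[? ?] /andP[? ?] /andP[? ?]; apply/andP; split; lra.
  have [|||c cxy] := @MVT_segment R f ('D_1 f) x y.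
  - exact: ltW.
  - by move=> z /subset_itv_oo_cc /bxy; exact: fd.
  - apply: derivable_within_continuous => z /bxy /fd [+ _]; exact.
  rewrite fxy subrr => /esym/eqP; rewrite mulf_eq0 subr_eq0 (gt_eqF xy) orbF.
  by have [_ /negP] := rU _ (bxy _ cxy).
(* Off the image of the ball [g] takes the default value [x0]; near [f x0] a preimage in the ball
   exists and is unique. *)
pose g y := xget x0 [set x | ball x0 r x /\ f x = y].
have fK x : ball x0 r x -> g (f x) = x.
  move=> bx; rewrite /g; case: xgetP => [z _ [bz fz]|/(_ x)]; last by case.
  by have [/(inj _ _ bz bx)|/(inj _ _ bx bz)|//] := ltgtP z x; rewrite fz.
have nb x : ball x0 r x -> nbhs x (ball x0 r).
  by move=> bx; apply: open_nbhs_nbhs; split => //; exact: ball_open.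
have nK x : ball x0 r x -> {near x, cancel f g}.
  by move=> /nb; apply: filterS => y /fK.
have nc x : ball x0 r x -> {near x, continuous f}.
  by move=> /nb; apply: filterS => y /fc.
have b0 : ball x0 r x0 by exact: ballxx.
have gfx0 := fK _ b0.
have [ngc ngK] := near_can_continuousAcan_sym (nK _ b0) (nc _ b0).
have nbg : \forall y \near f x0, ball x0 r (g y).
  have /= gc := nbhs_singleton ngc.
  by apply: (gc (ball x0 r)); rewrite gfx0; apply: nb.
exists g; split=> //.
have : nbhs (f x0) [set y | [/\ {for y, continuous g}, f (g y) = y & ball x0 r (g y)]].
  by near=> y; split; near: y.
rewrite nbhsE => -[U' [oU' Ux'] Ug].
have gd y : U' y -> is_derive y 1 g ('D_1 f (g y))^-1.
  move=> /Ug[_ fgy bg]; rewrite -[X in is_derive X]fgy.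
  apply: is_derive_inverse; [exact: nK|exact: nc|exact: fd|].
  by have [] := rU _ bg.
apply/Ck_nearP; exists U'; split=> //.
suff H j : (j <= k.+1)%N -> Ck j U' g by exact: H.
elim: j => [|j IH] jk; first by split=> // y /Ug[].
apply: (Ck_derive1 oU' gd).
apply: (Ck_comp basis_scalar basis_scalar (U' := [set x : R | x != 0]) (f := 'D_1 f
  \o g) (g := GRing.inv : R^o -> R^o)) => //; last exact: Ck_inv.
- by move=> y /Ug[_ _] /rU[].
apply: (Ck_comp basis_scalar basis_scalar (U' := U) (f := g : R^o -> R^o) (g := 'D_1
  f : R^o -> R^o)) => //.
- by move=> y /Ug[_ _] /rU[].
- by apply: IH; exact: ltnW.
- by apply: Ck_leq fD.
Unshelve. all: by end_near. Qed.

End RealFunctions.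

(** * Plots on a manifold *)

Section Plots.
Context {R : realType} {M : topologicalType} {n k : nat} (A : @Ck_atlas R M n k).

(** C^k functions on [M] and C^k maps on [M * M] send plots to C^k functions and to plots, and are
    characterised by this. The source [V] is arbitrary so that chart spaces, their products and the
    real line are all covered. *)
Definition plot_at (V : normedModType R) (p : V -> M) (x : V) :=
  {for x, continuous p} /\
  forall d, atlas A d -> chart_dom d (p x) -> Ck_near k (coord d \o p) x.

Lemma chart_codom_nbhs (a : @chart R M n) u : chart_codom a u -> nbhs u (chart_codom a).
Proof. by move=> au; apply: open_nbhs_nbhs; split=> //; exact: chart_codom_open. Qed.

Lemma chart_dom_nbhs (a : @chart R M n) x : chart_dom a x -> nbhs x (chart_dom a).
Proof. by move=> ax; apply: open_nbhs_nbhs; split=> //; exact: chart_dom_open. Qed.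

Lemma plot_cst (V : normedModType R) (y : M) (x : V) : plot_at (fun=> y) x.
Proof. by split=> [|d _ _]; [exact: cvg_cst|exact: Ck_near_cst]. Qed.

Lemma plot_param a u : atlas A a -> chart_codom a u -> plot_at (param a) u.
Proof.
move=> Aa au; have pc := param_continuous au.
split=> // d Ad du; rewrite /Ck_near.
have : nbhs u [set v | chart_codom a v /\ chart_dom d (param a v)].
  apply: filterI; first exact: chart_codom_nbhs.
  by apply: pc; exact: chart_dom_nbhs.
apply: filterS => v [[z az <-] dz].
apply: Ck_subset (atlas_compatible Aa Ad) => _ ->.
by exists z => //; split=> //; move: dz; rewrite coordK.
Qed.

Lemma plot_comp (V W : normedModType R) (bW : basis W) (p : W -> M) (f : V -> W) x :
  plot_at p (f x) -> Ck_near k f x -> plot_at (p \o f) x.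
Proof.
move=> [pc pk] fk; split.
  by apply: continuous_comp => //; exact: Ck_near_continuous fk.
move=> d Ad dx; apply: (Ck_near_comp bW (basis_row n) (f := f) (g := coord d \o p)) => //.
exact: pk.
Qed.

Lemma plot_eq (V : normedModType R) (p q : V -> M) x :
  (\near x, p x = q x) -> plot_at p x -> plot_at q x.
Proof.
move=> pq [pc pk]; have pqx : p x = q x := nbhs_singleton pq.
split; first by rewrite /prop_for/continuous_at -pqx; apply: cvg_trans pc;
  exact: near_eq_cvg.
move=> d Ad; rewrite -pqx => /(pk _ Ad); apply: Ck_near_eq.
by apply: filterS pq => y /= ->.
Qed.

Lemma Ck_fun_plot (g : M -> R) (V : normedModType R) (p : V -> M) x :
  Ck_fun A g -> plot_at p x -> Ck_near k (g \o p) x.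
Proof.
move=> [gc gk] [pc pk]; have [a Aa ax] := atlas_cover A (p x).
have nE : \forall y \near x, ((g \o param a) \o (coord a \o p)) y = (g \o p) y.
  have : nbhs x (p @^-1` chart_dom a) by exact: pc (chart_dom_nbhs ax).
  apply: filterS => y /= ay.
  by rewrite coordK.
apply: Ck_near_eq nE _.
apply: (Ck_near_comp (basis_row n) basis_scalar (f := coord a \o p) (g := g \o param
  a : _ -> R^o)).
  exact: pk.
apply/Ck_nearP; exists (chart_codom a); split; [exact: chart_codom_open|by exists (p
  x)|exact: gk].
Qed.

Lemma Ck_map2_plot (F : M -> M -> M) (V : normedModType R) (p q : V -> M) x :
  Ck_map2 A F -> plot_at p x -> plot_at q x -> plot_at (fun v => F (p v) (q v)) x.
Proof.
move=> [Fc Fk] [pc pk] [qc qk].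
have Fpq : {for x, continuous (fun v => F (p v) (q v))}.
  apply: (@continuous_comp _ _ _ (fun v => (p v, q v)) (fun p => F p.1 p.2));
    last exact: Fc.
  exact: (cvg_pair pc qc).
split=> // d Ad dx.
have [a Aa ax] := atlas_cover A (p x); have [b Ab bx] := atlas_cover A (q x).
pose G (u : 'rV[R]_n * 'rV[R]_n) := coord d (F (param a u.1) (param b u.2)).
have nE : \forall y \near x, G ((coord a \o p) y, (coord b \o q) y) = (coord d \o
  (fun v => F (p v) (q v))) y.
  have : nbhs x (p @^-1` chart_dom a `&` q @^-1` chart_dom b).
    by apply: filterI; [exact: pc (chart_dom_nbhs ax)|exact: qc (chart_dom_nbhs bx)].
  by apply: filterS => y [/= ay bY]; rewrite /G /= !coordK.
apply: Ck_near_eq nE _.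
apply: (Ck_near_comp (basis_prod (basis_row n) (basis_row n)) (basis_row n)
  (f := fun x => ((coord a \o p) x, (coord b \o q) x)) (g := G)).
  by apply: Ck_near_pair; [exact: basis_row|exact: basis_row|exact: pk|exact: qk].
rewrite /Ck_near /=.
have ca : chart_codom a (coord a (p x)) by exists (p x).
have cb : chart_codom b (coord b (q x)) by exists (q x).
pose c : 'rV[R]_n * 'rV[R]_n := (coord a (p x), coord b (q x)).
have FF : Filter (nbhs c) by exact: nbhs_filter.
have : nbhs c
    [set u | [/\ chart_codom a u.1, chart_codom b u.2 & chart_dom d (F (param a u.1)
      (param b u.2))]].
  have h1 : nbhs c [set u | chart_codom a u.1] :=
    @cvg_fst _ _ (nbhs (coord a (p x))) (nbhs (coord b (q x))) (nbhs_filter _) _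
      (chart_codom_nbhs ca).
  have h2 : nbhs c [set u | chart_codom b u.2] :=
    @cvg_snd _ _ (nbhs (coord a (p x))) (nbhs (coord b (q x))) (nbhs_filter _) _
      (chart_codom_nbhs cb).
  have h3 : nbhs c [set u | chart_dom d (F (param a u.1) (param b u.2))].
    apply: (@continuous_comp _ _ _ (fun u : 'rV[R]_n * 'rV[R]_n =>
      (param a u.1, param b u.2)) (fun p => F p.1 p.2)); last 2 first.
    - exact: Fc.
    - by rewrite /= !coordK//; exact: chart_dom_nbhs.
    apply: cvg_pair.
      by apply: continuous_comp; [exact: cvg_fst|exact: param_continuous].
    by apply: continuous_comp; [exact: cvg_snd|exact: param_continuous].
  by apply: (@filterS _ _ FF _ _ _ (@filterI _ _ FF _ _ h1 (@filterI _ _ FF _ _ h2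
    h3))) => u [? []].
apply: (@filterS _ _ FF) => u Su; apply: Ck_subset (Fk _ _ _ Aa Ab Ad) => _ -> //.
Unshelve. all: by end_near. Qed.

(** Pairs of parametrisations are enough plots: near a given pair of points [F] is the tested map
    composed with two continuous coordinate maps, and read in a third chart the tested map is the
    one in the definition of [Ck_map2]. *)
Lemma plot_Ck_map2 (F : M -> M -> M) :
  (forall a b u1 u2, atlas A a -> atlas A b -> chart_codom a u1 -> chart_codom b u2 ->
    plot_at (fun u => F (param a u.1) (param b u.2)) (u1, u2)) ->
  Ck_map2 A F.
Proof.
move=> H; split.
  move=> [y x].
  have [a Aa ay] := atlas_cover A y; have [b Ab bx] := atlas_cover A x.
  have ca : chart_codom a (coord a y) by exists y.
  have cb : chart_codom b (coord b x) by exists x.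
  have [Hc _] := H _ _ _ _ Aa Ab ca cb.
  pose G (u : 'rV[R]_n * 'rV[R]_n) := F (param a u.1) (param b u.2).
  have nE : \forall q \near (y, x), G (coord a q.1, coord b q.2) = F q.1 q.2.
    have h1 : nbhs (y, x) [set q | chart_dom a q.1] := @cvg_fst _ _ (nbhs y) (nbhs x)
      (nbhs_filter _) _ (chart_dom_nbhs ay).
    have h2 : nbhs (y, x) [set q | chart_dom b q.2] := @cvg_snd _ _ (nbhs y) (nbhs x)
      (nbhs_filter _) _ (chart_dom_nbhs bx).
    by apply: filterS (filterI h1 h2) => q [/= q1 q2]; rewrite /G /= !coordK.
  rewrite /continuous_at /=.
  have -> : F y x = G (coord a y, coord b x) by rewrite /G /= !coordK.
  apply: cvg_trans (near_eq_cvg nE) _.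
  have ca1 : (fun q : M * M => coord a q.1) @ (y, x) --> coord a y.
    exact: (@continuous_comp _ _ _ (fst : M * M -> M) (coord a) (y,
      x) cvg_fst (coord_continuous ay)).
  have cb1 : (fun q : M * M => coord b q.2) @ (y, x) --> coord b x.
    exact: (@continuous_comp _ _ _ (snd : M * M -> M) (coord b) (y,
      x) cvg_snd (coord_continuous bx)).
  exact: (@cvg_comp _ _ _ _ G _ _ _
    (@cvg_pair _ _ _ _ _ _ (nbhs_filter _) (nbhs_filter _) (nbhs_filter _) _ _ ca1 cb1) Hc).
move=> a b d Aa Ab Ad; apply/Ck_pointwise => -[u1 u2] [/= c1 c2 du].
have [_ /(_ d Ad du)] := H _ _ _ _ Aa Ab c1 c2.
by move=> /nbhs_singleton.
Unshelve. all: by end_near. Qed.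

End Plots.

(** * Laws on path space *)

Section GeneratedLaws.
Context {R : realType} {T : Type} {d1 d2 : measure_display}
  {T1 : measurableType d1} {T2 : measurableType d2}
  (P1 : probability T1 R) (P2 : probability T2 R) (Y1 : T1 -> T) (Y2 : T2 -> T).

(** Dynkin's argument. [T] carries no measurable structure, so measurability of both preimages goes
    through the induction together with the equality; complements and disjoint unions require it. *)
Lemma eq_prob_generated (G : set (set T)) : setI_closed G ->
  (forall A, G A -> [/\ measurable (Y1 @^-1` A), measurable (Y2 @^-1` A) &
     P1 (Y1 @^-1` A) = P2 (Y2 @^-1` A)]) ->
  forall A, <<s G>> A -> P1 (Y1 @^-1` A) = P2 (Y2 @^-1` A).
Proof.
move=> GI GP A; rewrite -setI_closed_g_dynkin_g_sigma_algebra// => GA.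
suff [] : [/\ measurable (Y1 @^-1` A), measurable (Y2 @^-1` A) &
     P1 (Y1 @^-1` A) = P2 (Y2 @^-1` A)] by [].
move: A GA; apply: smallest_sub => //; split.
- by rewrite !preimage_setT !probability_setT.
- move=> A [m1 m2 PA]; split; rewrite -?preimage_setC.
  + exact: measurableC.
  + exact: measurableC.
  + by rewrite (probability_setC _ m1) (probability_setC _ m2) PA.
- move=> F tF mF.
  have tr (U : Type) (Y : U -> T) : trivIset setT (fun n => Y @^-1` F n).
    apply/trivIsetP => i j _ _ ij; rewrite -preimage_setI.
    by move/trivIsetP : tF => /(_ _ _ I I ij) ->; rewrite preimage_set0.
  rewrite !preimage_bigcup; split.
  + by apply: bigcup_measurable => i _; have [] := mF i.
  + by apply: bigcup_measurable => i _; have [] := mF i.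
  + rewrite !measure_semi_bigcup//; last 4 first.
    * by move=> i; have [] := mF i.
    * by apply: bigcup_measurable => i _; have [] := mF i.
    * by move=> i; have [] := mF i.
    * by apply: bigcup_measurable => i _; have [] := mF i.
    by apply: eq_eseriesr => i _; have [] := mF i.
Qed.

End GeneratedLaws.

(** Fatou's lemma for events: [A] is contained in the lower limit of the [F n], the increasing union
    of the [G N]. *)
Lemma measure_eventually_le {R : realType} {d} {T : measurableType d}
    (P : probability T R) (F : nat -> set T) (A : set T) (p : \bar R) :
  (forall n, measurable (F n)) -> measurable A -> (forall n, (P (F n) <= p)%E) ->
  (forall w, A w -> exists N, forall n, (N <= n)%N -> F n w) -> (P A <= p)%E.
Proof.
move=> mF mA FP AF.
pose G N := \bigcap_(n in [set n | (N <= n)%N]) F n.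
have mG N : measurable (G N) by apply: bigcap_measurable => //; exists N => /=.
have AG : A `<=` \bigcup_N G N by move=> w /AF[N NF]; exists N.
have mUG : measurable (\bigcup_N G N) by apply: bigcup_measurable => i _.
apply: (@le_trans _ _ (P (\bigcup_N G N))); first by apply: le_measure; rewrite ?inE.
have nd : {homo G : n m / (n <= m)%N >-> (n <= m)%O}.
  by move=> n m nm; apply/subsetPset => w Gw i /= mi; apply: Gw => /=;
    exact: leq_trans nm mi.
have cv := nondecreasing_cvg_mu (mu := P) mG mUG nd.
rewrite -(cvg_lim (@ereal_hausdorff _) cv); apply: lime_le; first by apply/cvg_ex;
  eexists; exact: cv.
near=> N; apply: le_trans (FP N); apply: le_measure; rewrite ?inE//.
by move=> w; apply => /=.
Unshelve. all: by end_near. Qed.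

Section MetricBase.
Context {R : realType} {E : metricType R}.

(** This is stronger than a countable base: a full [e]-neighbourhood of [b i] stays in [U], so
    limits of points of [b i] remain in [U]. Balls about points of [D] with radius below [e / 4]
    leave that room. *)
Lemma separable_metric_base : separable_space E ->
  exists b : nat -> set E, (forall i, open (b i)) /\
  forall x U, nbhs x U -> exists i, b i x /\
    exists2 e : R, 0 < e & forall y, b i y -> ball y e `<=` U.
Proof.
move=> [D /countable_injP[f finj] Dd].
pose c (m : nat) (l : nat) : set E := [set y | exists2 d,
  D d & f d = m /\ ball d l.+1%:R^-1 y].
pose b (i : nat) := if @unpickle (nat * nat)%type i is Some (m, l) then (c m l)° else set0.
exists b; split.
  by move=> i; rewrite /b; case: unpickle => [[m l]|]; [exact: open_interior|exact: open0].
move=> x U /nbhs_ballP[e /= e0 eU].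
have [l le] : exists l : nat, l.+1%:R^-1 < e / 4.
  have e4 : 0 < e / 4 by rewrite divr_gt0.
  have [N _ /(_ N (leqnn N))] := near_infty_natSinv_lt (PosNum e4).
  by exists N.
pose r : R := l.+1%:R^-1.
have r0 : 0 < r by rewrite invr_gt0.
have r2 : 0 < r / 2 by rewrite divr_gt0.
have : (ball x (r / 2))° `&` D !=set0.
  apply: Dd; last exact: open_interior.
  by exists x; apply: nbhsx_ballx.
move=> [d [/interior_subset xd Dd']].
exists (pickle (f d, l)); rewrite /b pickleK; split.
  rewrite /interior /=.
  apply: filterS (nbhsx_ballx x _ r2) => y xy; exists d => //; split=> //.
  by rewrite -/r (splitr r); apply: ball_triangle xy; exact: ball_sym.
exists (e / 2); first by rewrite divr_gt0.
move=> y /interior_subset [d' Dd'' [/finj E' dy]] z yz.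
rewrite E' ?inE// in dy.
apply: eU; apply: (@le_ball _ _ _ (r / 2 + r + e / 2)); first by rewrite -/r in le; lra.
by apply: ball_triangle yz; apply: ball_triangle dy.
Qed.

End MetricBase.

Section PathSets.
Context {R : realType} {M : topologicalType}.
Implicit Types (w : path_space R M) (U : set M).

Definition alive_in (U : set M) (z : cemetery M) : Prop :=
  if z is Some x then U x else False.

Definition at_time (t : R) (U : set M) : set (path_space R M) :=
  [set w | alive_in U (w t)].

Lemma alive_inE U : alive_in U = Some @` U.
Proof.
by apply/seteqP; split=> -[x|] //= => [|[y Uy [<-]]|[]//]; first by exists x.
Qed.

Lemma alive_in_measurable U : open U -> measurable (alive_in U : set (borel_cemetery M)).
Proof.
move=> oU; rewrite alive_inE; apply: sub_sigma_algebra.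
exact: one_point_compactification_open_some.
Qed.

(** An open set containing the cemetery is the union of its living part and the cemetery point, and
    that point is the complement of [alive_in setT]. Hence the sets of living states alone
    generate. *)
Lemma borel_cemetery_ind (K : set (set (cemetery M))) : sigma_algebra setT K ->
  (forall U, open U -> K (alive_in U)) ->
  (@measurable _ (borel_cemetery M)) `<=` K.
Proof.
move=> Ks KU; apply: smallest_sub => // O oO.
have [K0 KC Kb] := Ks.
have oV : open (Some @^-1` O : set M).
  by have /continuousP := @one_point_compactification_some_continuous M; apply.
have [ON|ON] := pselect (O None).
  have -> : O = setT `\` (setT `\` (\bigcup_k (fun n =>
    if n is 0%N then alive_in (Some @^-1` O) else setT `\` alive_in setT) k)).
    apply/seteqP; split=> [[x|] Ox|].
    - by split=> // -[_]; apply; exists 0%N.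
    - by split=> // -[_]; apply; exists 1%N => //; split=> //; case.
    - move=> [x|] // [_ h]; apply: contrapT => nO; apply: h;
      split=> // -[[_ /= Ox|n _ [_ h]]]; first exact: nO.
      by apply: h.
  do 2!apply: (KC); apply: Kb => -[|n]; first exact: KU.
  by apply: (KC); apply: (KU); exact: openT.
have -> : O = alive_in (Some @^-1` O) by apply/seteqP; split=> -[x|].
exact: KU.
Qed.

Lemma at_time_path t U : 0 <= t -> open U -> path_sigma_algebra R M (at_time t U).
Proof.
move=> t0 oU; apply: sub_sigma_algebra; exists t => //.
by exists (alive_in U) => //; exact: alive_in_measurable.
Qed.

Lemma path_sigma_ind (K : set (set (path_space R M))) : sigma_algebra setT K ->
  (forall t U, 0 <= t -> open U -> K (at_time t U)) -> path_sigma_algebra R M `<=` K.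
Proof.
move=> Ks KU; apply: smallest_sub => // _ [t t0 [B mB ->]].
have [K0 KC Kb] := Ks.
have : K ((fun w => w t) @^-1` B); last by [].
move: B mB; apply: borel_cemetery_ind; last by move=> U oU; exact: KU.
split.
- by rewrite /= preimage_set0.
- by move=> B KB /=; have := KC _ KB; rewrite !setTD preimage_setC.
- by move=> F KF; rewrite /= preimage_bigcup; exact: Kb.
Qed.

Lemma path_sigma_algebra_sigma : sigma_algebra setT (path_sigma_algebra R M).
Proof. exact: smallest_sigma_algebra. Qed.

Lemma path_preimage (Phi : path_space R M -> path_space R M) :
  (forall t U, 0 <= t -> open U -> path_sigma_algebra R M (Phi @^-1` at_time t U)) ->
  forall A, path_sigma_algebra R M A -> path_sigma_algebra R M (Phi @^-1` A).
Proof.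
move=> H; apply: path_sigma_ind => //; have [K0 KC Kb] := path_sigma_algebra_sigma.
split.
- by rewrite /= preimage_set0.
- by move=> B KB /=; have := KC _ KB; rewrite !setTD preimage_setC.
- by move=> F KF; rewrite /= preimage_bigcup; exact: Kb.
Qed.

Definition rescale (h : M -> M) (c : R) (w : path_space R M) : path_space R M :=
  fun t => omap h (w (c * t)).

Lemma rescale_at_time h c t U w :
  at_time t U (rescale h c w) = at_time (c * t) (h @^-1` U) w.
Proof. by rewrite /at_time /rescale /=; case: (w _). Qed.

Lemma rescale_path h c A : continuous h -> 0 < c -> path_sigma_algebra R M A ->
  path_sigma_algebra R M (rescale h c @^-1` A).
Proof.
move=> hc c0; apply: path_preimage => t U t0 oU.
have -> : rescale h c @^-1` at_time t U = at_time (c * t) (h @^-1` U).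
  by apply/funext => w; rewrite /preimage /= rescale_at_time.
apply: at_time_path; first by rewrite mulr_ge0// ltW.
by move/continuousP: hc; apply.
Qed.

Lemma shift_path (s : R) A : 0 <= s -> path_sigma_algebra R M A ->
  path_sigma_algebra R M ((fun w t => w (s + t)) @^-1` A).
Proof. by move=> s0; apply: path_preimage => t U t0 oU; apply: at_time_path => //;
  rewrite addr_ge0. Qed.

Lemma rescale_comp h h' c c' w : rescale h' c' (rescale h c w) = rescale (h' \o h) (c
  * c') w.
Proof. by apply/funext => t; rewrite /rescale mulrA; case: (w _). Qed.

Lemma rescale_shift h c s w :
  rescale h c (fun t => w (c * s + t)) = (fun t => rescale h c w (s + t)).
Proof. by apply/funext => t; rewrite /rescale mulrDr. Qed.

Lemma rescale_id w : rescale id 1 w = w.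
Proof. by apply/funext => t; rewrite /rescale mul1r; case: (w _). Qed.

(** Right-continuity at living times and absorption in the cemetery, phrased without the topology of
    the compactification and without a starting point. In this form it passes directly to rescaled
    paths. *)
Definition right_regular w := forall t, 0 <= t ->
  if w t is Some x then
    forall U, nbhs x U -> exists2 d : R, 0 < d & forall s, t <= s < t + d -> at_time s U w
  else forall s, t <= s -> w s = None.

Lemma cadlag_right_regular y w : cadlag_from y w -> right_regular w.
Proof.
move=> [_ rc _ dead _] t t0; case wt : (w t) => [x|]; last first.
  move=> s ts; apply/dead; first exact: le_trans ts.
  by apply: le_trans (_ : t%:E <= _)%E; [exact/dead|rewrite lee_fin].
move=> U xU; have := rc t t0; rewrite wt => wc.
have : nbhs (t^'+) (w @^-1` (Some @` U)).
  by apply: wc; exact: one_point_compactification_some_nbhs.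
rewrite -alive_inE => /nbhs_ballP[d /= d0 dU]; exists d => // s /andP[ts std].
have [<-|nts] := eqVneq t s; first by rewrite /at_time /= wt /=; exact: nbhs_singleton.
apply: dU; last by rewrite lt_neqAle nts.
by rewrite -ball_normE/= ltr_distlC; apply/andP; split; lra.
Qed.

Lemma rescale_right_regular h c w : continuous h -> 0 < c ->
  right_regular w -> right_regular (rescale h c w).
Proof.
move=> hc c0 wr t t0; have ct0 : 0 <= c * t by rewrite mulr_ge0// ltW.
have := wr _ ct0; case E : (w (c * t)) => [x|] H; rewrite [rescale h c w t]/rescale E
  /=; last first.
  by move=> s ts; rewrite /rescale H// ler_wpM2l// ltW.
move=> U /hc /H [d d0 dU]; exists (d / c); first exact: divr_gt0.
move=> s /andP[ts std]; rewrite rescale_at_time; apply: dU.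
have : c * s < c * (t + d / c) by rewrite ltr_pM2l.
by rewrite mulrDr (mulrC d) mulVKf ?gt_eqF// ler_wpM2l// ltW.
Qed.

End PathSets.

Section Homeo.
Context {E : topologicalType}.

Definition homeo_comp (g f : homeo E) : homeo E :=
  @Homeo E (g \o f) (homeo_inv f \o homeo_inv g)
    (can_comp (homeo_funK g) (homeo_funK f))
    (can_comp (homeo_invK f) (homeo_invK g))
    (fun x => continuous_comp (@homeo_fun_continuous _ f x) (@homeo_fun_continuous _
      g (f x)))
    (fun x => continuous_comp (@homeo_inv_continuous _ g x) (@homeo_inv_continuous _ f _)).

Definition homeo_sym (f : homeo E) : homeo E :=
  Homeo (homeo_invK f) (homeo_funK f) (@homeo_inv_continuous _ f)
    (@homeo_fun_continuous _ f).

Definition homeo_id : homeo E :=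
  @Homeo E id id (fun=> erefl) (fun=> erefl) (fun=> cvg_id) (fun=> cvg_id).

End Homeo.

Section Shrink.
Context {R : realType} {M : metricType R}.

(** Closed sets that increase to [U] when [U] is open; they supply the bound that open sets do not
    give in a limit of laws. *)
Definition shrink (U : set M) (m : nat) : set M := [set x | ball x m.+1%:R^-1 `<=` U].

Lemma shrink_closed U m : open (~` shrink U m).
Proof.
rewrite openE => x /= nx.
have [y [xy nUy]] : exists y, ball x m.+1%:R^-1 y /\ ~ U y.
  apply: contrapT => h; apply: nx => y xy; apply: contrapT => nUy; apply: h.
  by exists y.
rewrite ballEmdist /= in xy.
apply/nbhs_ballP; exists (m.+1%:R^-1 - mdist x y); first by rewrite /= subr_gt0.
move=> z xz zs; apply: nUy; apply: zs; rewrite ballEmdist /=.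
move: xz; rewrite ballEmdist /= => xz.
by rewrite (le_lt_trans (metric_triangle z x y))// (metric_sym z x) -ltrBrDr.
Qed.

Lemma shrink_subset U m : shrink U m `<=` U.
Proof. by move=> x; apply; apply: ballxx; rewrite invr_gt0. Qed.

Lemma shrink_nd U m n : (m <= n)%N -> shrink U m `<=` shrink U n.
Proof.
move=> mn x; apply: subset_trans; apply: le_ball.
by rewrite lef_pV2 ?posrE// ler_nat.
Qed.

Lemma shrink_bigcup U : open U -> forall x, U x -> exists m, shrink U m x.
Proof.
rewrite openE => oU x /oU /nbhs_ballP[e /= e0 eU].
have [N _ /(_ N (leqnn N)) /= Ne] := near_infty_natSinv_lt (PosNum e0).
by exists N; apply: subset_trans eU; apply: le_ball; exact: ltW.
Qed.

End Shrink.

Section Cylinders.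
Context {R : realType} {M : metricType R}.

Inductive cylinder : set (set (path_space R M)) :=
| cylinderT : cylinder setT
| cylinderI t U C : 0 <= t -> open U -> cylinder C -> cylinder (at_time t U `&` C).

Lemma cylinder_setI : setI_closed cylinder.
Proof.
move=> A B cA cB; elim: cA => [|t U C t0 oU cC IH]; first by rewrite setTI.
by rewrite -setIA; apply: cylinderI.
Qed.

Lemma path_setI (A B : set (path_space R M)) : path_sigma_algebra R M A ->
  path_sigma_algebra R M B -> path_sigma_algebra R M (A `&` B).
Proof. exact: (@measurableI _ (g_sigma_algebraType _)). Qed.

Lemma path_setT : path_sigma_algebra R M setT.
Proof. exact: (@measurableT _ (g_sigma_algebraType _)). Qed.

Lemma path_setC (A : set (path_space R M)) : path_sigma_algebra R M A ->
  path_sigma_algebra R M (~` A).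
Proof. exact: (@measurableC _ (g_sigma_algebraType _)). Qed.

Lemma cylinder_path C : cylinder C -> path_sigma_algebra R M C.
Proof.
elim => [|t U D t0 oU cD IH]; first exact: path_setT.
by apply: path_setI => //; exact: at_time_path.
Qed.

Lemma path_cylinder : path_sigma_algebra R M `<=` <<s cylinder>>.
Proof.
apply: path_sigma_ind; first exact: smallest_sigma_algebra.
move=> t U t0 oU; apply: sub_sigma_algebra; rewrite -(setIT (at_time t U)).
by apply: cylinderI => //; exact: cylinderT.
Qed.

Lemma at_time_closed_path t (F : set M) : 0 <= t -> open (~` F) ->
  path_sigma_algebra R M (at_time t F).
Proof.
move=> t0 oF; have -> : at_time t F = at_time t setT `&` ~` at_time t (~` F).
  apply/seteqP; split=> w; rewrite /at_time /=; case: (w t) => //= x.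
    by move=> Fx; split=> //; exact.
    by move=> [_ /contrapT].
  by case: x.
apply: path_setI; first by apply: at_time_path => //; exact: openT.
by apply: path_setC; exact: at_time_path.
Qed.

End Cylinders.

(** * Similarity of laws and its closure under limits *)

Section Similarity.
Context {R : realType} {M : metricType R} (X : process R M).
Hypothesis X_cadlag : forall y (w : Omega X y), cadlag_from y (traj w).

Definition similar (y z : M) (h : homeo M) (c : R) : Prop :=
  eq_law (Pr X z) (Pr X y) (@traj _ _ X z) (fun w => rescale h c (traj w)).

Lemma traj_path y A : path_sigma_algebra R M A -> measurable (@traj _ _ X y @^-1` A).
Proof.
move: A; apply: path_sigma_ind.
  split.
  - by rewrite /= preimage_set0.
  - by move=> A mA; rewrite /= setTD -preimage_setC; exact: measurableC.
  - by move=> F mF; rewrite /= preimage_bigcup; exact: bigcup_measurable.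
move=> t U t0 oU.
by have := @traj_measurable _ _ X y t t0 measurableT _ (alive_in_measurable oU);
  rewrite setTI.
Qed.

Lemma rescale_traj_path y (h : homeo M) c A : 0 < c -> path_sigma_algebra R M A ->
  measurable ((fun w => rescale h c (@traj _ _ X y w)) @^-1` A).
Proof.
move=> c0 mA; apply: (@traj_path y (rescale h c @^-1` A)).
by apply: rescale_path => //; exact: homeo_fun_continuous.
Qed.

Lemma similar_comp y z v h h' c c' : 0 < c' ->
  similar y z h c -> similar z v h' c' -> similar y v (homeo_comp h' h) (c * c').
Proof.
move=> c'0 yz zv A mA; rewrite zv//.
have mA' : path_sigma_algebra R M (rescale h' c' @^-1` A).
  by apply: rescale_path => //; exact: homeo_fun_continuous.
transitivity (Pr X y ((fun w => rescale h c (traj w)) @^-1` (rescale h' c' @^-1` A))).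
  exact: (yz _ mA').
by congr (_ _); apply/seteqP; split=> w /=; rewrite rescale_comp.
Qed.

Lemma similar_sym y z h c : 0 < c -> similar y z h c -> similar z y (homeo_sym h) c^-1.
Proof.
move=> c0 yz A mA.
have mA' : path_sigma_algebra R M (rescale (homeo_sym h) c^-1 @^-1` A).
  by apply: rescale_path => //; [exact: homeo_fun_continuous|rewrite invr_gt0].
transitivity (Pr X z ((fun w => rescale (homeo_sym h) c^-1 (traj w)) @^-1` A)); last first.
  by [].
transitivity (Pr X y ((fun w => rescale h c (traj w)) @^-1` (rescale (homeo_sym h)
  c^-1 @^-1` A))); last first.
  exact/esym/(yz _ mA').
congr (_ _); apply/seteqP; split=> w /=; rewrite rescale_comp mulfV ?gt_eqF//.
  have -> : homeo_sym h \o h = id by apply/funext => x /=; rewrite homeo_funK.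
  by rewrite rescale_id.
have -> : homeo_sym h \o h = id by apply/funext => x /=; rewrite homeo_funK.
by rewrite rescale_id.
Qed.

Lemma similar_ext y z (h h' : homeo M) c : h =1 h' -> similar y z h c -> similar y z h' c.
Proof. by move=> /funext E; rewrite /similar E. Qed.

(** All paths of [X_z] are at [z] at time 0. If [h y] were another point, the event of being alive
    elsewhere than at [z] at time 0 would have probability 0 for [X_z] and 1 for the transform of
    [X_y]. *)
Lemma similar_point y z h c : similar y z h c -> h y = z.
Proof.
move=> yz; apply: contrapT => hy.
have mA : path_sigma_algebra R M (at_time 0 (~` [set z])).
  apply: at_time_path => //; apply: closed_openC.
  exact: (accessible_closed_set1 (hausdorff_accessible (@metric_hausdorff R M))).
have := yz _ mA.
have -> : @traj _ _ X z @^-1` at_time 0 (~` [set z]) = set0.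
  apply/seteqP; split=> // w; rewrite /at_time /=.
  by have [-> _ _ _ _] := X_cadlag w; apply.
have -> : (fun w => rescale h c (@traj _ _ X y w)) @^-1` at_time 0 (~` [set z]) = setT.
  apply/seteqP; split=> // w _; rewrite /preimage/= rescale_at_time /at_time /= mulr0.
  by have [-> _ _ _ _] := X_cadlag w.
by rewrite measure0 probability_setT => /eqP; rewrite eq_sym onee_eq0.
Qed.

(* The scales must approach their limit from above because paths are only
   right-continuous. *)
Section Limit.
Variables (y z : M) (h : nat -> homeo M) (c : nat -> R) (h0 : homeo M) (c0 : R).
Hypothesis c0_gt0 : 0 < c0.
Hypothesis sim : forall n, similar y z (h n) (c n).
Hypothesis c0_le : forall n, c0 <= c n.
Hypothesis c_cvg : c @ \oo --> c0.
Hypothesis h_cvg : forall x U, nbhs (h0 x) U -> exists2 V, nbhs x V &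
  \forall n \near \oo, V `<=` h n @^-1` U.

Let c_gt0 n : 0 < c n. Proof. exact: lt_le_trans c0_gt0 (c0_le n). Qed.

(** The map and the point move together: [c n * t] tends to [c0 * t] from above, so the path
    position falls into any neighbourhood [V] of its limit, and [h_cvg] controls [h n] on a whole
    such [V] at once. *)
Lemma at_time_cvg w t U : right_regular w -> 0 <= t -> open U ->
  at_time t U (rescale h0 c0 w) ->
  \forall n \near \oo, at_time t U (rescale (h n) (c n) w).
Proof.
move=> rw t0 oU wU; have : alive_in (h0 @^-1` U) (w (c0 * t)).
  by move: wU; rewrite rescale_at_time.
have := rw (c0 * t) (mulr_ge0 (ltW c0_gt0) t0).
case E : (w (c0 * t)) => [x|]//= wV Ux.
have [V xV hV] := h_cvg (open_nbhs_nbhs (conj oU Ux)).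
have [d d0 dV] := wV V xV.
have [N _ Nd] : \forall n \near \oo, c n * t < c0 * t + d.
  have cc : (fun n => c n * t) @ \oo --> c0 * t by apply: cvgMr_tmp.
  have /cvgrPdist_lt/(_ d d0) := cc; apply: filterS => n.
  by rewrite distrC => /ltr_distlDr; rewrite addrC.
near=> n; rewrite rescale_at_time.
have : at_time (c n * t) V w.
  by apply: dV; rewrite ler_wpM2r//=; apply: Nd => /=; near: n; exists N.
have hn : V `<=` h n @^-1` U by near: n.
by rewrite /at_time/=; case: (w _) => //= x' /hn.
Unshelve. all: by end_near. Qed.

Lemma at_time_closed_cvg w t F : right_regular w -> 0 <= t -> open (~` F) ->
  ~ at_time t F (rescale h0 c0 w) ->
  \forall n \near \oo, ~ at_time t F (rescale (h n) (c n) w).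
Proof.
move=> rw t0 oF; case E : (w (c0 * t)) => [x|] nF.
  have : at_time t (~` F) (rescale h0 c0 w).
    by move: nF; rewrite !rescale_at_time /at_time /= E.
  move=> /(at_time_cvg rw t0 oF); apply: filterS => n.
  by rewrite !rescale_at_time /at_time/=; case: (w _).
(* A path that is dead at [c0 * t] is dead at the later time [c n * t]; this again uses approach
   from above. *)
apply: nearW => n; rewrite rescale_at_time /at_time /=.
have := rw (c0 * t) (mulr_ge0 (ltW c0_gt0) t0); rewrite E => ->//.
by rewrite ler_wpM2r.
Qed.

Lemma cylinder_cvg w C : right_regular w -> cylinder C ->
  C (rescale h0 c0 w) -> \forall n \near \oo, C (rescale (h n) (c n) w).
Proof.
move=> rw; elim=> [|t U D t0 oU cD IH]; first by move=> _; exact: nearW.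
by move=> [/(at_time_cvg rw t0 oU) H1 /IH H2]; near=> n; split; near: n.
Unshelve. all: by end_near. Qed.

(** Replacing each open set of the cylinder by its closed subsets [shrink U m] gives events
    increasing to the cylinder whose complements persist for large [n]. *)
Lemma cylinder_shrink C : cylinder C -> exists D : nat -> set (path_space R M),
  [/\ forall m, path_sigma_algebra R M (D m),
      forall m n, (m <= n)%N -> D m `<=` D n, \bigcup_m D m = C &
      forall m w, right_regular w -> ~ D m (rescale h0 c0 w) ->
        \forall n \near \oo, ~ D m (rescale (h n) (c n) w)].
Proof.
elim=> [|t U C' t0 oU cC [D [D1 D2 D3 D4]]].
  exists (fun=> setT); split=> //; first by move=> _; exact: path_setT.
    by apply/seteqP; split=> // w _; exists 0%N.
  by move=> m w _; case.
exists (fun m => at_time t (shrink U m) `&` D m); split.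
- by move=> m; apply: path_setI => //; apply: at_time_closed_path => //;
  exact: shrink_closed.
- move=> m n mn; apply: setISS; last exact: D2.
  by move=> w; rewrite /at_time/=; case: (w t) => //= x; exact: shrink_nd.
- rewrite -D3; apply/seteqP; split=> w.
    move=> [m _ [wm Dm]]; split; last by exists m.
    by move: wm; rewrite /at_time/=; case: (w t) => //= x; exact: shrink_subset.
  move=> [wU [m _ Dm]].
  have [m' wm'] : exists m', at_time t (shrink U m') w.
    by move: wU; rewrite /at_time/=; case: (w t) => //= x; exact: shrink_bigcup.
  exists (maxn m m') => //; split; last by apply: D2 Dm; rewrite leq_maxl.
  move: wm'; rewrite /at_time/=; case: (w t) => //= x; apply: shrink_nd.
  by rewrite leq_maxr.
- move=> m w rw /not_andP[nU|nD].
    have := at_time_closed_cvg rw t0 (@shrink_closed _ _ U m) nU.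
    by apply: filterS => n nn [].
  by have := D4 m w rw nD; apply: filterS => n nn [].
Qed.

(** A portmanteau argument in which all approximating laws equal that of [X_z]. Cylinders persist
    for large [n], which bounds their limit probability by the one for [X_z]; the complements of the
    closed approximations [D m] give the reverse bound. *)
Lemma similar_limit : similar y z h0 c0.
Proof.
move=> A /path_cylinder; apply: eq_prob_generated; first exact: cylinder_setI.
move=> C cC; have mC := cylinder_path cC.
split; [exact: traj_path|exact: rescale_traj_path|].
have rr w := cadlag_right_regular (X_cadlag (w : Omega X y)).
apply/eqP; rewrite eq_le; apply/andP; split; last first.
  apply: (@measure_eventually_le _ _ _ _
    (fun n => (fun w => rescale (h n) (c n) (@traj _ _ X y w)) @^-1` C)).
  - by move=> n; exact: rescale_traj_path.
  - exact: rescale_traj_path.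
  - by move=> n; rewrite (sim n mC).
  - by move=> w /(cylinder_cvg (rr w) cC) [N _ NC]; exists N => n Nn; exact: NC.
have [D [D1 D2 D3 D4]] := cylinder_shrink cC.
have DC m : (Pr X z (@traj _ _ X z @^-1` D m) <= Pr X y ((fun w =>
  rescale h0 c0 (@traj _ _ X y w)) @^-1` C))%E.
  apply: (@le_trans _ _ (Pr X y ((fun w => rescale h0 c0 (@traj _ _ X y w)) @^-1` D
    m))); last first.
    apply: le_measure; rewrite ?inE; [exact: rescale_traj_path|exact: rescale_traj_path|].
    by move=> w /= Dw; rewrite -D3; exists m.
  have : (Pr X y (~` ((fun w => rescale h0 c0 (@traj _ _ X y w)) @^-1` D m)) <=
          Pr X z (~` (@traj _ _ X z @^-1` D m)))%E.
    apply: (@measure_eventually_le _ _ _ _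
      (fun n => ~` ((fun w => rescale (h n) (c n) (@traj _ _ X y w)) @^-1` D m))).
    - by move=> n; apply: measurableC; exact: rescale_traj_path.
    - by apply: measurableC; exact: rescale_traj_path.
    - by move=> n; rewrite !probability_setC ?(sim n (D1 m))//;
      [exact: traj_path|exact: rescale_traj_path].
    - by move=> w /(D4 m _ (rr w)) [N _ NC]; exists N => n Nn; exact: NC.
  have m1 := @traj_path z _ (D1 m).
  have m2 := @rescale_traj_path y h0 _ _ c0_gt0 (D1 m).
  rewrite (probability_setC _ m1) (probability_setC _ m2).
  have f1 := fin_num_measure (Pr X z) _ m1.
  have f2 := fin_num_measure (Pr X y) _ m2.
  by rewrite -(fineK f1) -(fineK f2) -!EFinB !lee_fin lerD2l lerN2.
rewrite -D3 preimage_bigcup in DC *.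
have nd : {homo (fun m => @traj _ _ X z @^-1` D m) : n m / (n <= m)%N >-> (n <= m)%O}.
  by move=> n m nm; apply/subsetPset => w; exact: D2.
have mU : measurable (\bigcup_m (@traj _ _ X z @^-1` D m)).
  by apply: bigcup_measurable => m _; exact: traj_path.
have cv := nondecreasing_cvg_mu (mu := Pr X z) (fun m => @traj_path z _ (D1 m)) mU nd.
rewrite -(cvg_lim (@ereal_hausdorff _) cv); apply: lime_le.
  by apply/cvg_ex; eexists; exact: cv.
exact: nearW.
Qed.

End Limit.

End Similarity.

(** * Almost-everywhere identities and countable determination of path laws *)

Section AlmostEverywhere.
Local Open Scope ereal_scope.

(** Under the distribution of [phi] the two functions have the same integral over every measurable
    set, so they agree almost everywhere. Passing to that distribution puts the null set among the
    values of [phi] and not among outcomes. *)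
Lemma ae_eq_of_integrals {R : realType} {d d'} {T : measurableType d}
    {T' : measurableType d'} (P : probability T R) (phi : T -> T') (u v : T' -> \bar R) :
  measurable_fun setT phi -> measurable_fun setT u -> measurable_fun setT v ->
  (forall x, 0 <= u x <= 1) -> (forall x, 0 <= v x <= 1) ->
  (forall B, measurable B -> \int[P]_(w in phi @^-1` B) u (phi w) =
     \int[P]_(w in phi @^-1` B) v (phi w)) ->
  exists N, [/\ measurable N, P (phi @^-1` N) = 0 & forall x, ~ N x -> u x = v x].
Proof.
move=> mphi mu mv u01 v01 uv.
pose phim : {mfun T >-> T'} := mfun_Sub (mem_set mphi).
have int B (g : T' -> \bar R) : measurable B -> measurable_fun setT g -> (forall x,
  0 <= g x <= 1) ->
    \int[distribution P phim]_(y in B) g y = \int[P]_(w in phi @^-1` B) g (phi w).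
  move=> mB mg g01; apply: (@ge0_integral_pushforward _ _ _ _ _ _ mphi P) => //.
    exact: measurable_funS mg.
  by move=> x _; have /andP[] := g01 x.
have iu : (distribution P phim).-integrable setT u.
  apply/integrableP; split=> //.
  apply: (@le_lt_trans _ _ (\int[distribution P phim]_(x in setT) cst 1 x)).
    apply: ge0_le_integral => //.
    - exact: measurableT_comp.
    - by move=> x _; have /andP[u0 u1] := u01 x; rewrite gee0_abs.
  by rewrite integral_cst// mul1e /= /distribution /pushforward preimage_setT
    probability_setT ltry.
have [N [mN N0 Nuv]] : ae_eq (distribution P phim) setT u v.
  apply: integral_ae_eq => // E _ mE.
  by rewrite !int//; exact: uv.
exists N; split=> // x nN; apply: contrapT => nuv; apply: nN; apply: Nuv => /= h.
by apply: nuv; apply: h.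
Qed.

End AlmostEverywhere.

Section CountableDetermination.
Context {R : realType} {M : metricType R}.
Variable b : nat -> set M.
Hypothesis b_open : forall i, open (b i).
Hypothesis b_base : forall x U, nbhs x U -> exists i, b i x /\
  exists2 e : R, 0 < e & forall y, b i y -> ball y e `<=` U.

(** A countable pi-system indexed by finite lists; the absolute value turns any rational into an
    admissible time. *)
Definition rational_cylinder (s : seq (rat * nat)) : set (path_space R M) :=
  foldr (fun p C => at_time `|ratr p.1 : R| (b p.2) `&` C) setT s.

Lemma rational_cylinder_path s : path_sigma_algebra R M (rational_cylinder s).
Proof.
elim: s => [|p s IH]; first exact: path_setT.
by apply: path_setI => //; apply: at_time_path.
Qed.

Lemma rational_cylinder_setI : setI_closed (range rational_cylinder).
Proof.
move=> _ _ [s _ <-] [s' _ <-]; exists (s ++ s') => //.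
elim: s => [|p s IH] /=; first by rewrite setTI.
by rewrite IH setIA.
Qed.

(** A right-regular path is in [U] at [t] exactly when, along rational times tending to [t] from
    above, it is eventually in one [b i] that keeps a positive distance from the complement of [U].
    The distance serves the converse, where [w t] is only a limit of points of [b i]. *)
Lemma at_time_rational t U : 0 <= t -> open U -> exists A,
  <<s range rational_cylinder>> A /\ forall w, right_regular w -> (at_time t U w <-> A w).
Proof.
move=> t0 oU.
have /choice[q qt] : forall n : nat, exists q : rat, t < `|ratr q : R| < t + n.+1%:R^-1.
  move=> n; have /rat_in_itvoo[q] : t < t + n.+1%:R^-1 by rewrite ltrDl invr_gt0.
  rewrite in_itv/= => /andP[tq qt]; exists q; rewrite gtr0_norm ?tq//.
  exact: le_lt_trans tq.
pose good i := exists2 e : R, 0 < e & forall y, b i y -> ball y e `<=` U.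
pose A : set (path_space R M) := \bigcup_(i in good) \bigcup_N \bigcap_(n in [set n |
  (N <= n)%N])
  at_time `|ratr (q n)| (b i).
exists A; split.
  have mq n i : <<s range rational_cylinder>> (at_time `|ratr (q n)| (b i)).
    apply: sub_sigma_algebra; exists [:: (q n, i)] => //.
    by rewrite /rational_cylinder/= setIT.
  have m1 i : @measurable _ (g_sigma_algebraType (range rational_cylinder))
      (\bigcup_N \bigcap_(n in [set n | (N <= n)%N]) at_time `|ratr (q n)| (b i)).
    apply: bigcup_measurable => N _; apply: bigcap_measurable; first by exists N => /=.
    by move=> n _; exact: mq.
  exact: (@bigcup_measurable _ (g_sigma_algebraType (range rational_cylinder)) _ _
    (fun i _ => m1 i)).
move=> w rw; split.
  have := rw t t0; rewrite /at_time/=; case E : (w t) => [x|]//= wV Ux.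
  have [i [bx gi]] := b_base (open_nbhs_nbhs (conj oU Ux)).
  have [d d0 dV] := wV _ (open_nbhs_nbhs (conj (b_open i) bx)).
  have [N _ Nd] := near_infty_natSinv_lt (PosNum d0).
  exists i => //; exists N => // n /= Nn; apply: dV.
  have /andP[tq qd] := qt n; rewrite ltW//= (lt_trans qd)// ltrD2l.
  exact: (Nd n Nn).
move=> [i [e e0 ie] [N _ wN]].
have := rw t t0; rewrite /at_time/=; case E : (w t) => [x|] H.
  have xe : nbhs x (ball x e) by exact: nbhsx_ballx.
  have [d d0 dV] := H _ xe.
  have [N' _ Nd] := near_infty_natSinv_lt (PosNum d0).
  have /= := wN (maxn N N'); rewrite leq_maxl => /(_ isT).
  have /andP[tq qd] := qt (maxn N N').
  have : at_time `|ratr (q (maxn N N'))| (ball x e) w.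
    apply: dV; rewrite ltW//= (lt_trans qd)// ltrD2l.
    by apply: (Nd (maxn N N')); rewrite /= leq_maxr.
  rewrite /at_time/=; case: (w _) => //= y xy bY; apply: ie bY _ _.
  exact: ball_sym.
have /= := wN N (leqnn N); rewrite /at_time/= H//.
by have /andP[/ltW] := qt N.
Qed.

(* On right-continuous paths the sigma-algebra is countably generated, so a single
   null set serves all events at once. *)
Lemma path_rational A : path_sigma_algebra R M A -> exists B,
  <<s range rational_cylinder>> B /\ forall w, right_regular w -> (A w <-> B w).
Proof.
move: A; apply: path_sigma_ind; last exact: at_time_rational.
have [K0 KC Kb] := smallest_sigma_algebra setT (range rational_cylinder).
split=> /=.
- by exists set0; split.
- move=> A [B [mB AB]]; exists (setT `\` B); split; first exact: KC.
  by move=> w /AB h; rewrite /setD /= h.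
- move=> F /choice[G FG]; exists (\bigcup_n G n); split.
    by apply: Kb => n; have [] := FG n.
  move=> w rw; split=> -[n _ H]; exists n => //; have [_ h] := FG n.
    by apply/(h w rw).
  by apply/(h w rw).
Qed.

Lemma eq_law_rational d1 d2 (T1 : measurableType d1) (T2 : measurableType d2)
    (P1 : probability T1 R) (P2 : probability T2 R)
    (Y1 : T1 -> path_space R M) (Y2 : T2 -> path_space R M) :
  (forall w, right_regular (Y1 w)) -> (forall w, right_regular (Y2 w)) ->
  (forall A, path_sigma_algebra R M A -> measurable (Y1 @^-1` A)) ->
  (forall A, path_sigma_algebra R M A -> measurable (Y2 @^-1` A)) ->
  (forall s, P1 (Y1 @^-1` rational_cylinder s) = P2 (Y2 @^-1` rational_cylinder s)) ->
  eq_law P1 P2 Y1 Y2.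
Proof.
move=> r1 r2 m1 m2 P12 A /path_rational[B [mB AB]].
have -> : Y1 @^-1` A = Y1 @^-1` B by apply/seteqP; split=> w /=; apply AB.
have -> : Y2 @^-1` A = Y2 @^-1` B by apply/seteqP; split=> w /=; apply AB.
move: B mB {AB}; apply: eq_prob_generated; first exact: rational_cylinder_setI.
move=> _ [s _ <-]; have mC := rational_cylinder_path s.
by split; [exact: m1|exact: m2|exact: P12].
Qed.

End CountableDetermination.

(** * Markov property and support *)

Section Markov.
Context {R : realType} {M : metricType R} (X : process R M).
Hypothesis X_markov : strong_markov_cadlag X.

Let X_cadlag := X_markov.1.

Lemma traj_time_measurable y t : 0 <= t ->
  measurable_fun setT (fun w : Omega X y => traj w t : borel_cemetery M).
Proof. exact: traj_measurable. Qed.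

Lemma law_measurable A : path_sigma_algebra R M A ->
  measurable_fun [set: borel_cemetery M] (law X ^~ A).
Proof. by have [h _] := X_markov.2; exact: h. Qed.

Lemma law_itv x A : path_sigma_algebra R M A -> (0 <= law X x A <= 1)%E.
Proof.
move=> mA; case: x => [x|] /=.
  by rewrite measure_ge0 probability_le1//; apply: traj_path.
by rewrite !lee_fin indicE; case: (_ \in _); rewrite lexx ler01.
Qed.

(** The strong Markov property at a deterministic time; the work is to check that a constant is a
    stopping time and that the condition on [traj w s] is prior to it. *)
Lemma markov_at y s (B : set (borel_cemetery M)) A : 0 <= s -> measurable B ->
  path_sigma_algebra R M A ->
  Pr X y ((fun w : Omega X y => traj w s) @^-1` B `&`
          [set w | A (fun t => traj w (s + t))]) =
  (\int[Pr X y]_(w in (fun w : Omega X y => traj w s) @^-1` B) law X (traj w s) A)%E.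
Proof.
move=> s0 mB mA; have [_ /(_ y (fun=> s%:E) ((fun w => traj w s) @^-1` B) A)] := X_markov.2.
have st : stopping_time (fun _ : Omega X y => s%:E).
  split=> [_|t t0]; first by rewrite lee_fin.
  have [K0 KC _] := smallest_sigma_algebra setT
    [set C | exists2 s : R, 0 <= s <= t & exists2 B : set (borel_cemetery M), measurable B &
         C = [set w : Omega X y | B (traj w s)]].
  case: (s%:E <= t%:E)%E.
    have -> : [set w : Omega X y | true] = setT `\` set0 by apply/seteqP;
      split=> // w; split.
    exact: KC.
  have -> : [set w : Omega X y | false] = set0 by apply/seteqP; split.
  exact: K0.
have ev : stopped_event (fun _ : Omega X y => s%:E) ((fun w => traj w s) @^-1` B).
  split.
    by have := @traj_time_measurable y _ s0 measurableT _ mB; rewrite setTI.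
  move=> t t0.
  have [K0 KC _] := smallest_sigma_algebra setT
    [set C | exists2 s : R, 0 <= s <= t & exists2 B : set (borel_cemetery M), measurable B &
         C = [set w : Omega X y | B (traj w s)]].
  have [st'|st'] := leP s t.
    have -> : [set w : Omega X y | (s%:E <= t%:E)%E] = setT.
      by apply/seteqP; split=> // w _ /=; rewrite lee_fin.
    rewrite setIT; apply: sub_sigma_algebra; exists s; first by rewrite s0.
    by exists B.
  have -> : [set w : Omega X y | (s%:E <= t%:E)%E] = set0.
    by apply/seteqP; split=> // w /=; rewrite lee_fin leNgt st'.
  by rewrite setI0.
move=> /(_ st ev mA) /=.
have -> : [set w : Omega X y | (s%:E < +oo)%E /\ A (fun t => traj w (s + t))] =
   [set w | A (fun t => traj w (s + t))].
  by apply/seteqP; split=> w /=; [case|rewrite ltry].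
have -> : [set w : Omega X y | (s%:E < +oo)%E] = setT.
  by apply/seteqP; split=> // w _ /=; rewrite ltry.
by rewrite setIT.
Qed.

Lemma omap_measurable (h : M -> M) : continuous h ->
  measurable_fun setT (omap h : borel_cemetery M -> borel_cemetery M).
Proof.
move=> hc _ B mB; rewrite setTI; move: B mB; apply: borel_cemetery_ind.
  split.
  - by rewrite /= preimage_set0.
  - by move=> A mA; rewrite /= setTD -preimage_setC; exact: measurableC.
  - by move=> F mF; rewrite /= preimage_bigcup; exact: bigcup_measurable.
move=> U oU /=.
have -> : omap h @^-1` (alive_in U) = alive_in (h @^-1` U) by apply/seteqP; split=> -[].
by apply: alive_in_measurable; move/continuousP: hc; apply.
Qed.

Section Transport.
Variables (y0 y : M) (h : homeo M) (c : R).
Hypothesis c_gt0 : 0 < c.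
Hypothesis y0y : similar X y0 y h c.

Let hc : continuous h := @homeo_fun_continuous _ h.

(* Both sides are the law of [h (X_{y0} (c .))] after time [s / c], seen either
   as [X_y] or as a transform of [X_{y0}], on the event [X_{y0} s \in B]. *)
Lemma transport_integrals s (B : set (borel_cemetery M)) A : 0 <= s -> measurable B ->
  path_sigma_algebra R M A ->
  (\int[Pr X y0]_(w in (fun w : Omega X y0 => traj w s) @^-1` B)
      law X (omap h (traj w s)) A =
   \int[Pr X y0]_(w in (fun w : Omega X y0 => traj w s) @^-1` B)
      law X (traj w s) (rescale h c @^-1` A))%E.
Proof.
move=> s0 mB mA.
have mA' : path_sigma_algebra R M (rescale h c @^-1` A) by exact: rescale_path.
rewrite -markov_at//.
pose B' : set (borel_cemetery M) := omap (homeo_inv h) @^-1` B.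
have mB' : measurable B'.
  by have := omap_measurable (@homeo_inv_continuous _ h) measurableT mB; rewrite setTI.
have T0 : 0 <= s / c by rewrite divr_ge0// ltW.
have cT : c * (s / c) = s by rewrite mulrC divfK ?gt_eqF.
have oh (x : cemetery M) : omap (homeo_inv h) (omap h x) = x.
  by case: x => //= x; rewrite homeo_funK.
have := markov_at y T0 mB' mA.
pose E : set (path_space R M) := [set w | B' (w (s / c)) /\ A (fun t => w (s / c + t))].
have mE : path_sigma_algebra R M E.
  apply: path_setI; last exact: shift_path.
  by apply: sub_sigma_algebra; exists (s / c) => //; exists B'.
have -> : (fun w : Omega X y => traj w (s / c)) @^-1` B' `&`
          [set w | A (fun t => traj w (s / c + t))] = @traj _ _ X y @^-1` E by [].
rewrite (y0y mE).
have -> : (fun w : Omega X y0 => rescale h c (traj w)) @^-1` E =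
  (fun w : Omega X y0 => traj w s) @^-1` B `&`
          [set w | (rescale h c @^-1` A) (fun t => traj w (s + t))].
  have k (w : Omega X y0) : (fun t => rescale h c (traj w) (s / c + t)) =
      rescale h c (fun t => traj w (s + t)).
    by rewrite -rescale_shift cT.
  apply/funext => w; rewrite /E /B' /preimage /mkset /setI /mkset k.
  by rewrite [rescale h c (traj w) (s / c)]/rescale cT oh.
move=> ->.
(* Both remaining integrals are integrals of [law X ^~ A] over [B'] against image measures: the law
   of [h (X_{y0} s)] and the law of [X_y (s / c)]. These agree by [y0y]. *)
have mu : measurable_fun B' (law X ^~ A) by apply: measurable_funS (law_measurable mA).
have u0 : {in B', forall x, (0 <= law X x A)%E}.
  by move=> x _; have /andP[] := law_itv x mA.
have mtau : measurable_fun setT (fun w : Omega X y0 =>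
  omap h (traj w s) : borel_cemetery M).
  by apply: (measurableT_comp (omap_measurable hc)); exact: traj_time_measurable.
have I1 := ge0_integral_pushforward (@traj_time_measurable y _ T0) (Pr X y) mB' mu u0.
have I2 := ge0_integral_pushforward mtau (Pr X y0) mB' mu u0.
transitivity (\int[pushforward (Pr X y0) (fun w : Omega X y0 =>
  omap h (traj w s) : borel_cemetery M)]_(x in B') law X x A)%E.
  rewrite I2; congr (integral _ _ _); apply/seteqP; split=> w /=; by rewrite /B' /= oh.
rewrite -[RHS]I1; apply: eq_measure_integral; first exact: (@traj_time_measurable y _ T0).
move=> _ D mD _ /=.
have mDT : path_sigma_algebra R M [set w | D (w (s / c))].
  by apply: sub_sigma_algebra; exists (s / c) => //; exists D.
have := y0y mDT; rewrite /pushforward.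
have -> : (fun w : Omega X y0 => rescale h c (traj w)) @^-1` [set w | D (w (s / c))] =
  (fun w : Omega X y0 => omap h (traj w s)) @^-1` D.
  by apply/seteqP; split=> w /=; rewrite /rescale cT.
by move=> <-.
Qed.

End Transport.

End Markov.

Lemma metric_ball_open {R : realType} {M : metricType R} (x : M) (r : R) : open (ball x r).
Proof.
rewrite openE => y; rewrite ballEmdist /= => xy.
apply/nbhs_ballP; exists (r - mdist x y); first by rewrite /= subr_gt0.
move=> z; rewrite !ballEmdist /= => yz.
by rewrite (le_lt_trans (metric_triangle x y z))// addrC -ltrBrDr.
Qed.

Section Support.
Context {R : realType} {M : metricType R} (X : process R M).
Hypothesis X_markov : strong_markov_cadlag X.
Hypothesis M_separable : separable_space M.

Let X_cadlag := X_markov.1.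

Lemma alive_in_ball y z e s : [set w : Omega X y | exists2 x,
  ball z e x & traj w s = Some x] =
  (fun w : Omega X y => traj w s) @^-1` alive_in (ball z e).
Proof.
apply/seteqP; split=> w; first by case=> x zx; rewrite /preimage/= => ->.
by rewrite /preimage/=; case: (traj w s) => //= x zx; exists x.
Qed.

Lemma at_ball_measurable y z e s : 0 <= s ->
  measurable ((fun w : Omega X y => traj w s) @^-1` alive_in (ball z e)).
Proof.
move=> s0; have := @traj_time_measurable _ _ X y s s0 measurableT _
  (alive_in_measurable (metric_ball_open z e)).
by rewrite setTI.
Qed.

(** For each rational cylinder the integrated identity holds pointwise off a null set of states.
    [X_{y0}] is in the ball at some time [s] with positive probability, so some outcome is in the
    ball at [s] and avoids these countably many null sets; its position is [x]. *)
Lemma similar_dense y0 y h c z e : 0 < c -> similar X y0 y h c ->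
  Supp X y0 z -> 0 < e -> exists2 x, ball z e x & similar X x (h x) h c.
Proof.
move=> c0 y0y /[apply] -[s s0]; rewrite alive_in_ball => Ppos.
have [b [b_open b_base]] := separable_metric_base M_separable.
have hc : continuous h := @homeo_fun_continuous _ h.
pose C := rational_cylinder (R := R) b.
have mC k : path_sigma_algebra R M (C k) by exact: rational_cylinder_path.
have mC' k : path_sigma_algebra R M (rescale h c @^-1` C k) by exact: rescale_path.
pose phi (w : Omega X y0) : borel_cemetery M := traj w s.
have mphi : measurable_fun setT phi by exact: traj_time_measurable.
have /choice[N NP] : forall k, exists N, [/\ measurable N, Pr X y0 (phi @^-1` N) = 0%E &
    forall x, ~ N x -> law X (omap h x) (C k) = law X x (rescale h c @^-1` C k)].
  move=> k; apply: ae_eq_of_integrals => //.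
  - by apply: (measurableT_comp (law_measurable X_markov (mC k))); exact: omap_measurable.
  - exact: law_measurable.
  - by move=> x; exact: law_itv.
  - by move=> x; exact: law_itv.
  - by move=> B mB; exact: (transport_integrals X_markov c0 y0y).
pose N' (n : nat) : set (Omega X y0) := phi @^-1` (if unpickle n is Some k then N k
  else set0).
have N'0 : (Pr X y0).-negligible (\bigcup_n N' n).
  apply: negligible_bigcup => n; rewrite /N'; case: unpickle => [k|].
    exists (phi @^-1` N k); have [mN N0 _] := NP k; split=> //.
    by have := mphi measurableT _ mN; rewrite setTI.
  by rewrite preimage_set0; exact: negligible_set0.
have [w [wz wN]] : exists w : Omega X y0, alive_in (ball z e) (traj w s) /\ ~
  (\bigcup_n N' n) w.
  apply: contrapT => H; move: Ppos; rewrite (@measure_negligible _ _ _ (Pr X y0)) ?ltxx//.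
    exact: at_ball_measurable.
  apply: negligibleS N'0 => w wz; apply: contrapT => nw; apply: H.
  by exists w.
case E : (traj w s) wz => [x|]//= zx; exists x => //.
apply: (eq_law_rational b_open b_base).
- by move=> v; apply: cadlag_right_regular (X_cadlag v).
- by move=> v; apply: rescale_right_regular => //; apply: cadlag_right_regular (X_cadlag v).
- by move=> A; exact: traj_path.
- by move=> A; exact: rescale_traj_path.
move=> k; have [_ _ Nk] := NP k.
have /Nk : ~ N k (Some x).
  by move=> Nx; apply: wN; exists (pickle k) => //; rewrite /N' pickleK /preimage /phi/= E.
by [].
Qed.

(* If the scales do not approach [c0] from above along a subsequence, those of the
   inverse pairs approach [c0^-1] from above. *)
Lemma similar_seq y z (h : nat -> homeo M) (c : nat -> R) (h0 : homeo M) (c0 : R) :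
  0 < c0 -> (forall n, 0 < c n) -> (forall n, similar X y z (h n) (c n)) -> c @ \oo
    --> c0 ->
  (forall x U, nbhs (h0 x) U -> exists2 V, nbhs x V & \forall n \near \oo,
    V `<=` h n @^-1` U) ->
  (forall x U, nbhs (homeo_inv h0 x) U ->
    exists2 V, nbhs x V & \forall n \near \oo, V `<=` homeo_inv (h n) @^-1` U) ->
  similar X y z h0 c0.
Proof.
move=> c00 cn0 sim cc hc hic.
have [often|] := pselect (forall N, exists2 n, (N <= n)%N & c0 <= c n).
  have /choice[k kP] : forall N, exists n, (N <= n)%N /\ c0 <= c n.
    by move=> N; have [n ? ?] := often N; exists n.
  have koo : k @ \oo --> \oo.
    by move=> A [N _ NA]; exists N => // n /= Nn; apply: NA; apply: leq_trans Nn (kP n).1.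
  apply: (similar_limit X_cadlag c00 (h := h \o k) (c := c \o k)).
  - by move=> n; exact: sim.
  - by move=> n; have [] := kP n.
  - exact: cvg_comp koo cc.
  - by move=> x U /hc[V xV hV]; exists V => //; exact: (koo _ hV).
move=> /existsNP[N Nc].
have lt n : (N <= n)%N -> c n < c0.
  by move=> Nn; rewrite ltNge; apply/negP => cn; apply: Nc; exists n.
have koo : addn N @ \oo --> \oo.
  by move=> A [K _ KA]; exists K => // n /= Kn; apply: KA => /=;
    rewrite (leq_trans Kn)// leq_addl.
have : similar X z y (homeo_sym h0) c0^-1.
  apply: (similar_limit X_cadlag (h := fun n => homeo_sym (h (N + n)%N)) (c := fun n
    => (c (N + n)%N)^-1)).
  - by rewrite invr_gt0.
  - by move=> n; apply: similar_sym => //; exact: sim.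
  - by move=> n; rewrite lef_pV2 ?posrE// ltW// lt// leq_addr.
  - apply: cvgV; first by rewrite gt_eqF.
    exact: cvg_comp koo cc.
  - by move=> x U /hic[V xV hV]; exists V => //; exact: (koo _ hV).
move=> /similar_sym; rewrite invrK invr_gt0 => /(_ c00).
exact: similar_ext.
Qed.

Lemma similar_Supp y z h c x : 0 < c -> similar X y z h c -> Supp X y x -> Supp X z (h x).
Proof.
move=> c0 yz yx e e0.
have /nbhs_ballP[d /= d0 dh] : nbhs x (h @^-1` ball (h x) e).
  by apply: homeo_fun_continuous; exact: nbhsx_ballx.
have [t t0] := yx d d0; rewrite alive_in_ball => tP.
exists (t / c); first by rewrite divr_ge0// ltW.
rewrite alive_in_ball.
have mt : path_sigma_algebra R M (at_time (t / c) (ball (h x) e)).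
  by apply: at_time_path; [rewrite divr_ge0// ltW|exact: metric_ball_open].
have E : Pr X z ((fun w => traj w (t / c)) @^-1` alive_in (ball (h x) e)) =
    Pr X y ((fun w => rescale h c (traj w)) @^-1` at_time (t / c) (ball (h x) e)).
  exact: (yz _ mt).
rewrite E; apply: lt_le_trans tP _; apply: le_measure; rewrite ?inE.
- exact: at_ball_measurable.
- exact: rescale_traj_path.
move=> w; rewrite /preimage/= rescale_at_time mulrC divfK ?gt_eqF// /at_time/=.
by case: (traj w t) => //= x' /dh.
Qed.

Lemma Supp_start y : Supp X y y.
Proof.
move=> e e0; exists 0 => //; rewrite (_ : [set w | _] = setT) ?probability_setT//.
apply/seteqP; split=> // w _ /=; exists y; first exact: ballxx.
by have [-> _ _ _ _] := X_cadlag w.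
Qed.

Lemma Supp_closed y : closed (Supp X y).
Proof.
rewrite -openC openE => z /= nz.
have [e e0 ez] : exists2 e : R, 0 < e & forall t, 0 <= t ->
    ~ (0 < Pr X y [set w | exists2 x, ball z e x & traj w t = Some x])%E.
  apply: contrapT => H; apply: nz => e e0; apply: contrapT => H'; apply: H.
  by exists e => // t t0 Pt; apply: H'; exists t.
apply/nbhs_ballP; exists e => //= z' zz' Sz'.
have /nbhs_ballP[d /= d0 dz] : nbhs z' (ball z e).
  by apply: open_nbhs_nbhs; split=> //; exact: metric_ball_open.
have [t t0 tP] := Sz' d d0; apply: (ez t t0); apply: lt_le_trans tP _.
rewrite !alive_in_ball; apply: le_measure; rewrite ?inE;
  [exact: at_ball_measurable|exact: at_ball_measurable|].
by move=> w; rewrite /preimage /=; case: (traj w t) => //= x /dz.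
Qed.

End Support.

Lemma continuous_op2 {S T U V : topologicalType} (F : T -> U -> V) (p : S -> T) (q :
  S -> U) :
  continuous (fun x : T * U => F x.1 x.2) -> continuous p -> continuous q ->
  continuous (fun x => F (p x) (q x)).
Proof.
move=> Fc pc qc x.
apply: (@continuous_comp _ _ _ (fun v => (p v, q v)) (fun x : T * U => F x.1 x.2));
  last exact: Fc.
exact: (cvg_pair (pc x) (qc x)).
Qed.

(** * Return maps and fullness of the support *)

Section Components.
Context {R : realType} {M : metricType R} (X : process R M).
Hypothesis X_markov : strong_markov_cadlag X.
Hypothesis M_separable : separable_space M.
Variables (y0 : M) (f : M -> homeo M) (c : M -> R).
Hypothesis f_continuous : continuous (fun p : M * M => f p.1 p.2).
Hypothesis fi_continuous : continuous (fun p : M * M => homeo_inv (f p.1) p.2).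
Hypothesis c_gt0 : forall y, 0 < c y.
Hypothesis c_continuous : continuous c.
Hypothesis f_similar : forall y, similar X y0 y (f y) (c y).

Let X_cadlag := X_markov.1.

Definition return_map (y z : M) : homeo M :=
  homeo_comp (homeo_sym (f (f y z))) (homeo_comp (f y) (f z)).

Definition return_scale (y z : M) : R := c z * c y * (c (f y z))^-1.

Lemma return_scale_gt0 y z : 0 < return_scale y z.
Proof. by rewrite /return_scale !mulr_gt0// invr_gt0. Qed.

(** Joint continuity turns convergence of the parameters into the locally uniform convergence of
    maps that limits of similarities require. *)
Lemma joint_nbhs (z : nat -> M) (z0 : M) (F : M -> M -> M) x U :
  z @ \oo --> z0 -> continuous (fun p : M * M => F p.1 p.2) -> nbhs (F z0 x) U ->
  exists2 V, nbhs x V & \forall n \near \oo, V `<=` F (z n) @^-1` U.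
Proof.
move=> zc Fc FU; have [[A V] [/= Az Vx] AV] := Fc (z0, x) U FU.
have zA : \forall n \near \oo, A (z n) by exact: (zc A Az).
exists V => //; apply: filterS zA => n An v Vv.
exact: (AV (z n, v)).
Qed.

(** Density provides points [u n] tending to [z] at which [f y] transports the law. For them the
    loop from [y0] to [u n], then to [f y (u n)] and back, consists of similarities, and these loops
    converge to the one at [z]. *)
Lemma similar_return y z : Supp X y0 z -> similar X y0 y0 (return_map y z)
  (return_scale y z).
Proof.
move=> Sz.
have /choice[u uP] : forall n : nat, exists x, ball z n.+1%:R^-1 x /\ similar X x (f
  y x) (f y) (c y).
  move=> n; have [|x zx sx] := similar_dense X_markov M_separable (c_gt0 y)
    (f_similar y) Sz (e := n.+1%:R^-1).
    by rewrite invr_gt0.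
  by exists x.
have uz : u @ \oo --> z.
  move=> A /nbhs_ballP[e /= e0 eA].
  have := near_infty_natSinv_lt (PosNum e0); apply: filterS => n /= ne.
  apply: eA; have [zu _] := uP n; apply: le_ball zu; exact: ltW.
have fst_c : continuous (fst : M * M -> M) by move=> p; exact: cvg_fst.
have snd_c : continuous (snd : M * M -> M) by move=> p; exact: cvg_snd.
have fy_c : continuous (f y) by exact: homeo_fun_continuous.
have fyi_c : continuous (homeo_inv (f y)) by exact: homeo_inv_continuous.
have fyu_c : continuous (fun p : M * M => f y p.1).
  by move=> p; apply: continuous_comp; [exact: fst_c|exact: fy_c].
apply: (similar_seq X_markov (h := return_map y \o u) (c := return_scale y \o u)).
- exact: return_scale_gt0.
- by move=> n; exact: return_scale_gt0.
- move=> n; have [_ s2] := uP n; have s1 := f_similar (u n).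
  have s3 := similar_sym (c_gt0 _) (f_similar (f y (u n))).
  apply: similar_comp s3; first by rewrite invr_gt0.
  exact: similar_comp s1 s2.
- have rc : continuous (return_scale y).
    move=> v; apply: cvgM.
      by apply: cvgM; [exact: c_continuous|exact: cvg_cst].
    apply: cvgV; first by rewrite gt_eqF.
    by apply: (@continuous_comp _ _ _ (f y) c); [exact: fy_c|exact: c_continuous].
  exact: cvg_comp uz (rc z).
- move=> x U; apply: (joint_nbhs (F := fun u x => return_map y u x) uz).
  have ffc : continuous (fun p : M * M => f y (f p.1 p.2)).
    by move=> p; apply: (@continuous_comp _ _ _ (fun p : M * M => f p.1 p.2) (f y));
      [exact: f_continuous|exact: fy_c].
  exact: (@continuous_op2 _ _ _ _ (fun u x => homeo_inv (f u) x) (fun p => f y p.1)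
    (fun p => f y (f p.1 p.2)) fi_continuous fyu_c ffc).
- move=> x U; apply: (joint_nbhs (F := fun u x => homeo_inv (return_map y u) x) uz).
  have fifc : continuous (fun p : M * M => homeo_inv (f y) (f (f y p.1) p.2)).
    move=> p; apply: (@continuous_comp _ _ _ (fun p : M * M =>
      f (f y p.1) p.2) (homeo_inv (f y))); last exact: fyi_c.
    exact: (@continuous_op2 _ _ _ _ (fun u x => f u x) (fun p : M * M =>
      f y p.1) snd f_continuous fyu_c snd_c).
  exact: (@continuous_op2 _ _ _ _ (fun u x => homeo_inv (f u) x) fst
    (fun p : M * M => homeo_inv (f y) (f (f y p.1) p.2)) fi_continuous fst_c fifc).
Qed.

(** A point [v] of the support of [X_z] is [f z x] with [x] in the support of [X_{y0}]. For [z']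
    near [z] the point [f z' x] is near [v] and in the support of [X_{z'}], so a ball about [v] is
    reached with positive probability from all positions near [z], and such positions are visited by
    [X_{y0}]. *)
Lemma Supp_transitive z : Supp X y0 z -> Supp X z `<=` Supp X y0.
Proof.
move=> Sz v Sv; pose x := homeo_inv (f z) v.
have xS : Supp X y0 x.
  have s := similar_sym (c_gt0 z) (f_similar z).
  have ci : 0 < (c z)^-1 by rewrite invr_gt0.
  exact: (similar_Supp ci s Sv).
have fzx : f z x = v by rewrite /x homeo_invK.
apply: contrapT => nSv.
have [e e0 ev] : exists2 e : R, 0 < e & forall t, 0 <= t ->
    Pr X y0 ((fun w => traj w t) @^-1` alive_in (ball v e)) = 0%E.
  apply: contrapT => H; apply: nSv => e e0; apply: contrapT => H'; apply: H.
  exists e => // t t0; apply/eqP; rewrite eq_le measure_ge0 andbT leNgt; apply/negP => Pt.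
  by apply: H'; exists t => //; rewrite alive_in_ball.
have [d d0 dV] : exists2 d : R, 0 < d & forall z', ball z d z' -> ball v e (f z' x).
  have : nbhs z [set z' | ball v e (f z' x)].
    have cf : continuous (fun z' => f z' x).
      apply: (@continuous_op2 _ _ _ _ (fun y => f y) id (fun=> x) f_continuous) => p.
        exact: cvg_id.
      exact: cvg_cst.
    by apply: (cf z); rewrite fzx; exact: nbhsx_ballx.
  by move=> /nbhs_ballP[d /= d0 dz]; exists d.
(* The time of the visit depends on [z']. A union over rational times is one event for all starting
   points, and right-continuity moves a visit to a rational time. *)
pose A : set (path_space R M) := \bigcup_n
  (if @unpickle rat n is Some q then at_time `|ratr q| (ball v e) else set0).
have mA : path_sigma_algebra R M A.
  have [K0 _ Kb] := @path_sigma_algebra_sigma R M.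
  apply: (Kb (fun n => if @unpickle rat n is Some q then at_time `|ratr q| (ball v e)
    else set0)) => n.
  by case: unpickle => // q; apply: at_time_path => //; exact: metric_ball_open.
have AP z' : ball z d z' -> (0 < law X (Some z') A)%E.
  move=> /dV fz'.
  have Sz' : Supp X z' (f z' x) by apply: (similar_Supp (c_gt0 z') (f_similar z')).
  have /nbhs_ballP[e' /= e'0 e'V] : nbhs (f z' x) (ball v e).
    by apply: open_nbhs_nbhs; split=> //; exact: metric_ball_open.
  have [t t0 tP] := Sz' e' e'0; apply: lt_le_trans tP _ => /=.
  rewrite alive_in_ball; apply: le_measure; rewrite ?inE.
  - exact: at_ball_measurable.
  - exact: traj_path.
  move=> w; rewrite /preimage/=.
  have := cadlag_right_regular (X_cadlag w) t0; case: (traj w t) => //= x' H /e'V Vx'.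
  have [d' d'0 dw] := H _ (open_nbhs_nbhs (conj (metric_ball_open v e) Vx')).
  have /rat_in_itvoo[q] : t < t + d' by rewrite ltrDl.
  rewrite in_itv/= => /andP[tq qt]; exists (pickle q); first exact: I.
  by rewrite pickleK gtr0_norm ?(le_lt_trans t0)//; apply: dw; rewrite ltW.
have [s s0] := Sz d d0; rewrite alive_in_ball => Ps.
pose B : set (Omega X y0) := (fun w => traj w s) @^-1` alive_in (ball z d).
have mB : measurable B by exact: at_ball_measurable.
have mbz : measurable (alive_in (ball z d) : set (borel_cemetery M)).
  by apply: alive_in_measurable; exact: metric_ball_open.
have := markov_at X_markov y0 s0 mbz mA; rewrite (@measure_negligible _ _ _ (Pr X
  y0)); last 2 first.
- by apply: measurableI => //; apply: (@traj_path _ _ X y0 _ (shift_path s0 mA)).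
- apply: (@negligibleS _ _ _ _ (\bigcup_n
    (if @unpickle rat n is Some q then (fun w : Omega X y0 =>
      traj w (s + `|ratr q|)) @^-1` alive_in (ball v e) else set0))).
    move=> w [_ [n _]]; case E : (unpickle n) => [q|]// wq; exists n => //.
    by rewrite E.
  apply: negligible_bigcup => n; case: unpickle => [q|]; last exact: negligible_set0.
  have sq : 0 <= s + `|ratr q| by rewrite addr_ge0.
  eexists; split; [exact: (@at_ball_measurable _ _ X y0 v e _ sq)|exact: ev|by []].
(* The integral over [B] of a function that is positive on [B] is now known to vanish, so [B] is
   null, against the choice of [s]. *)
have mL : measurable_fun B (fun w : Omega X y0 => law X (traj w s) A).
  apply: measurable_funS (measurableT) _ _ => //.
  by apply: (measurableT_comp (law_measurable X_markov mA)); exact: traj_time_measurable.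
have -> : (\int[Pr X y0]_(w in (fun w : Omega X y0 => traj w s) @^-1` alive_in (ball z d))
   law X (traj w s) A)%E = (\int[Pr X y0]_(w in B) `|law X (traj w s) A|)%E.
  apply: eq_integral => w _; rewrite gee0_abs//.
  by have /andP[] := law_itv X (traj w s) mA.
move=> /esym /(iffLR (ae_eq_integral_abs (Pr X y0) mB mL)) [N [mN N0 BN]].
have BN' : B `<=` N.
  move=> w Bw; apply: BN => /= H; have := H Bw; rewrite /cst.
  move: Bw; rewrite /B /preimage/=; case: (traj w s) => //= x' /AP /= + E.
  by rewrite E ltxx.
have : (Pr X y0 B <= 0)%E by rewrite -N0; apply: le_measure; rewrite ?inE.
by rewrite leNgt Ps.
Qed.

(** In the second case similarities carry the one given interior point to every [z], so each [z] is
    interior to its own support; [Supp_transitive] then makes [Supp X y0] open. *)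
Lemma Supp_full : connected [set: M] -> assumption1 X y0 \/ assumption2 X ->
  Supp X y0 = setT.
Proof.
move=> conn [//|[y yint]].
have Sint z : nbhs z (Supp X z).
  pose h := homeo_comp (f z) (homeo_sym (f y)).
  have ci : 0 < (c y)^-1 by rewrite invr_gt0.
  have hs : similar X y z h ((c y)^-1 * c z).
    by apply: similar_comp (f_similar z) => //; exact: similar_sym.
  have cc : 0 < (c y)^-1 * c z by rewrite mulr_gt0.
  have hy : h y = z by exact: (similar_point X_cadlag hs).
  have : nbhs z (homeo_inv h @^-1` Supp X y).
    by apply: homeo_inv_continuous; rewrite -hy homeo_funK.
  apply: filterS => x /(similar_Supp cc hs).
  by rewrite homeo_invK.
apply: conn.
- by exists y0; exact: Supp_start.
- exists (Supp X y0); last by rewrite setTI.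
  rewrite openE => z Sz; have := Sint z; apply: filterS.
  exact: Supp_transitive.
- exists (Supp X y0); last by rewrite setTI.
  exact: Supp_closed.
Qed.

End Components.

(** * Construction of the components *)

Section SmoothFamilies.
Context {R : realType} {M : topologicalType} {n k : nat} (A : @Ck_atlas R M n k).

(** Joint C^k dependence on parameter and point, for the maps and their inverses. Letting parameter
    and point both be functions of a common variable makes stability under composition immediate. *)
Definition smooth_family (H : R -> homeo M) (u : R) : Prop :=
  forall (V : normedModType R) (a : V -> R) (p : V -> M) x,
    Ck_near k a x -> a x = u -> plot_at A p x ->
    plot_at A (fun v => H (a v) (p v)) x /\
    plot_at A (fun v => homeo_inv (H (a v)) (p v)) x.

Lemma homeo_inv_eq (h h' : homeo M) : h =1 h' -> homeo_inv h =1 homeo_inv h'.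
Proof. by move=> hh' x; rewrite -{1}(homeo_invK h' x) -hh' homeo_funK. Qed.

Lemma smooth_family_comp (H H' : R -> homeo M) u : smooth_family H u -> smooth_family
  H' u ->
  smooth_family (fun v => homeo_comp (H v) (H' v)) u.
Proof.
move=> sH sH' V a p x ak au px.
have [p1 p2] := sH _ _ _ _ ak au px; have [q1 q2] := sH' _ _ _ _ ak au px; split.
  by have [] := sH _ _ _ _ ak au q1.
by have [] := sH' _ _ _ _ ak au p2.
Qed.

Lemma smooth_family_sym (H : R -> homeo M) u : smooth_family H u -> smooth_family
  (fun v => homeo_sym (H v)) u.
Proof. by move=> sH V a p x ak au px; have [p1 p2] := sH _ _ _ _ ak au px. Qed.

Lemma smooth_family_id u : smooth_family (fun=> homeo_id) u.
Proof. by []. Qed.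

Lemma smooth_family_reparam (H : R -> homeo M) (g : R -> R) u : Ck_near k g u ->
  smooth_family H (g u) -> smooth_family (H \o g) u.
Proof.
move=> gk sH V a p x ak au px; apply: (sH V (g \o a) p x) => //; last by rewrite /= au.
by apply: (Ck_near_comp basis_scalar basis_scalar (f := a : V -> R^o) (g := g : R^o
  -> R^o)); rewrite ?au.
Qed.

Lemma smooth_family_eq (H H' : R -> homeo M) u : (\forall v \near u, H v =1 H' v) ->
  smooth_family H u -> smooth_family H' u.
Proof.
move=> HH' sH V a p x ak au px; have [p1 p2] := sH _ _ _ _ ak au px.
have nx : \forall v \near x, H (a v) =1 H' (a v).
  by apply: (Ck_near_continuous ak (t := [set v | H v =1 H' v])); rewrite au.
split; [apply: plot_eq p1|apply: plot_eq p2].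
  by apply: filterS nx => v; apply.
by apply: filterS nx => v /homeo_inv_eq; apply.
Qed.

Lemma smooth_family_const (H : R -> homeo M) u0 u : smooth_family H u0 ->
  smooth_family (fun=> H u0) u.
Proof.
move=> sH V a p x ak au px; apply: (sH V (fun=> u0) p x) => //.
exact: Ck_near_cst.
Qed.

Definition homeo_pow (h : homeo M) (m : int) : homeo M :=
  match m with
  | Posz i => iter i (homeo_comp h) homeo_id
  | Negz i => iter i.+1 (homeo_comp (homeo_sym h)) homeo_id
  end.

Lemma iter_homeo_comp i (h : homeo M) x : iter i (homeo_comp h) homeo_id x = iter i h x.
Proof. by elim: i => //= i ->. Qed.

(** The extra factor is on the inner side, where [globalize] produces an [L 1] when an integer is
    approached from below. *)
Lemma homeo_powS h m x : homeo_pow h (m + 1) x = homeo_pow h m (h x).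
Proof.
case: m => [i|[|i]].
- have -> : Posz i + 1 = Posz i.+1 by rewrite -addn1.
  by rewrite /homeo_pow !iter_homeo_comp iterSr.
- by rewrite /= homeo_funK.
- have -> : Negz i.+1 + 1 = Negz i by rewrite !NegzE; lia.
  by rewrite /homeo_pow !iter_homeo_comp [in RHS]iterSr /= homeo_funK.
Qed.

Lemma smooth_family_pow h m u : smooth_family (fun=> h) u ->
  smooth_family (fun=> homeo_pow h m) u.
Proof.
move=> sh; have it g i : smooth_family (fun=> g) u ->
    smooth_family (fun=> iter i (homeo_comp g) homeo_id) u.
  by move=> sg; elim: i => [|i IH]; [exact: smooth_family_id|exact: smooth_family_comp].
by case: m => i; apply: it => //; exact: smooth_family_sym.
Qed.

End SmoothFamilies.

Section Globalize.
Context {R : realType} {M : topologicalType} {n k : nat} (A : @Ck_atlas R M n k).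
Variable L : R -> homeo M.
Hypothesis L0 : forall x, L 0 x = x.
Hypothesis L_smooth : forall u, `|u| < 2 -> smooth_family A L u.

(* Since [step] is locally constant near 0 and 1, the formula is that of
   [L 1 ^ m o L (u - m)] on both sides of an integer [m]. *)
Definition globalize (u : R) : homeo M :=
  let m := Num.floor u in let r := u - m%:~R in
  homeo_comp (homeo_pow (L 1) m) (homeo_comp (L (step k r)) (L (r - step k r))).

Lemma globalize_floor u (m : int) : m%:~R <= u < (m + 1)%:~R ->
  globalize u = homeo_comp (homeo_pow (L 1) m)
    (homeo_comp (L (step k (u - m%:~R))) (L (u - m%:~R - step k (u - m%:~R)))).
Proof. by move=> /floor_def um; rewrite /globalize um. Qed.

(** Just below [m] the floor is [m - 1] and [step] is 1, so the factor [L 1] joins the power; from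
    [m] on, [step] is 0 and the factor [L 0] disappears. The bound 1/4 is the length of these
    plateaus of [step]. *)
Lemma globalize_near_int u (m : int) : `|u - m%:~R| < 4^-1 ->
  globalize u =1 homeo_comp (homeo_pow (L 1) m) (L (u - m%:~R)).
Proof.
rewrite ltr_norml => /andP[um mu] x; have [mle|lem] := leP m%:~R u.
  rewrite (@globalize_floor _ m); last by rewrite mle intrD; lra.
  by rewrite step0 ?subr0 /= ?L0//; lra.
rewrite (@globalize_floor _ (m - 1)); last by rewrite subrK intrB lem; lra.
rewrite step1; last by rewrite intrB; lra.
have -> : u - (m - 1)%:~R - 1 = u - m%:~R by rewrite intrB; ring.
by rewrite /= -homeo_powS subrK.
Qed.

Lemma globalize0 x : globalize 0 x = x.
Proof.
rewrite (@globalize_near_int 0 0); last by rewrite subr0 normr0 invr_gt0.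
by rewrite subr0 /= L0.
Qed.

Lemma globalize_smooth u : smooth_family A globalize u.
Proof.
have L1 m v : smooth_family A (fun=> homeo_pow (L 1) m) v.
  apply: smooth_family_pow; apply: smooth_family_const; apply: L_smooth.
  by rewrite normr1 ltr1n.
pose m := Num.floor u.
have /andP[ml mr] : m%:~R <= u < (m + 1)%:~R by exact: floor_itv.
have sub_k (c : R) : Ck_near k (fun v : R => v - c) u.
  by apply: Ck_near_add; [exact: Ck_near_id|exact: Ck_near_cst].
(* At an integer the common formula of both sides is used; elsewhere the floor is locally constant.
   All arguments given to [L] stay between -1 and 1, within its range. *)
have [um|um] := eqVneq u m%:~R.
  apply: (@smooth_family_eq _ _ _ _ _ (fun v => homeo_comp (homeo_pow (L 1) m) ((L \o
    (fun v => v - m%:~R)) v))).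
    have : \forall v \near u, `|v - m%:~R| < 4^-1.
      have : nbhs u (ball u (4^-1 : R)) by apply: nbhsx_ballx; rewrite invr_gt0.
      by apply: filterS => v; rewrite -ball_normE /= -um distrC.
    by apply: filterS => v /globalize_near_int h x; rewrite h.
  apply: smooth_family_comp; first exact: L1.
  apply: smooth_family_reparam; first exact: sub_k.
  by apply: L_smooth; rewrite um subrr normr0.
have mlt : m%:~R < u by rewrite lt_neqAle eq_sym um.
have stk : Ck_near k (fun v : R => step k (v - m%:~R)) u.
  by apply: Ck_near_step; exact: sub_k.
have /andP[s0 s1] := step_itv k (u - m%:~R).
apply: (@smooth_family_eq _ _ _ _ _ (fun v => homeo_comp (homeo_pow (L 1) m)
   (homeo_comp ((L \o (fun v => step k (v - m%:~R))) v)
     ((L \o (fun v => v - m%:~R + (-1) * step k (v - m%:~R))) v)))).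
  have : \forall v \near u, m%:~R < v /\ v < (m + 1)%:~R.
    by apply: filterI; [exact: lt_nbhsr|exact: lt_nbhsl].
  apply: filterS => v [/ltW mv vm] x; rewrite (@globalize_floor _ m); last by rewrite mv.
  by rewrite /= mulN1r.
apply: smooth_family_comp; first exact: L1.
rewrite intrD in mr.
apply: smooth_family_comp; apply: smooth_family_reparam => //.
- by apply: L_smooth; rewrite ger0_norm//; lra.
- apply: Ck_near_add; first exact: sub_k.
  by apply: Ck_near_mul => //; exact: Ck_near_cst.
- by apply: L_smooth; rewrite ltr_norml; apply/andP; split; lra.
Qed.

End Globalize.
Arguments globalize {R M} k L u.

Lemma Ck_near_expR {R : realType} (V : normedModType R) k (f : V -> R) x :
  Ck_near k f x -> Ck_near k (fun x => expR (f x)) x.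
Proof.
move=> fk; apply: (Ck_near_comp basis_scalar basis_scalar (f := f : V -> R^o) (g :=
  @expR R : R^o -> R^o)) => //.
apply/Ck_nearP; exists setT; split=> //; first exact: openT.
elim: k {fk} => [|k IH]; first by split=> // y _; exact: continuous_expR.
by apply: (Ck_derive1 openT) IH => y _; exact: is_derive_expR.
Qed.

(** * From a non-constant return scale to local dilations *)

Section Direction.
Context {R : realType} {M : topologicalType} {n k : nat} (A : @Ck_atlas R M n k).

(** Otherwise the mean value bound with zero derivative makes [g] constant on small balls in charts,
    so its level sets are open as well as closed. *)
Lemma directional_derivative_neq0 (g : M -> R) (z1 z2 : M) : (0 < k)%N ->
  connected [set: M] -> continuous g ->
  (forall (V : normedModType R) (p : V -> M) x, plot_at A p x -> Ck_near k (g \o p) x) ->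
  g z1 != g z2 ->
  exists (a : chart M n) u v, [/\ atlas A a, chart_codom a u & 'D_v (g \o param a) u != 0].
Proof.
move=> k0 conn gc gk g12; apply: contrapT => nex.
have D0 a u v : atlas A a -> chart_codom a u -> 'D_v (g \o param a) u = 0.
  move=> Aa au; apply: contrapT => /eqP D; apply: nex; by exists a, u, v.
have : [set z | g z = g z2] = setT.
  apply: conn.
  - by exists z2.
  - exists [set z | g z = g z2]; last by rewrite setTI.
    rewrite openE => z /= gz; have [a Aa az] := atlas_cover A z.
    have cz : chart_codom a (coord a z) by exists z.
    have /nbhs_ballP[r /= r0 rball] := chart_codom_nbhs cz.
    have : nbhs z (chart_dom a `&` coord a @^-1` ball (coord a z) r).
      apply: filterI; first exact: chart_dom_nbhs.
      by apply: coord_continuous => //; exact: nbhsx_ballx.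
    apply: filterS => z' [az' bz']; rewrite -gz.
    have := @mean_value_line R _ (g \o param a) (coord a z) (coord a z' - coord a z) 1 0 0.
    rewrite /= scale1r subrK !coordK// mul0r mulr0 subr0 normr_le0 subr_eq0 => h.
    apply/eqP/h => s; rewrite normr1 => s1.
    have cs : chart_codom a (s *: (coord a z' - coord a z) + coord a z).
      apply: rball; rewrite -ball_normE /= opprD addrCA subrr addr0 normrN normrZ.
      rewrite (le_lt_trans (ler_piMl _ s1))// distrC.
      by move: bz'; rewrite /preimage /= -ball_normE.
    rewrite subr0 (D0 _ _ _ Aa cs) normr0 lexx; split=> //.
    have := gk _ _ _ (plot_param Aa cs); move=> /nbhs_singleton /= gC.
    exact: Ck_derivable (Ck_leq k0 gC) _ _ erefl.
  - exists [set z | g z = g z2]; last by rewrite setTI.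
    apply: (@preimage_closed _ _ g [set x | x = g z2]); last exact: closed_eq.
    by move=> x _; exact: gc.
move=> gE; have : [set z | g z = g z2] z1 by rewrite gE.
by move=> /= /eqP; rewrite (negPf g12).
Qed.

End Direction.

Section GoodComponents.
Context {R : realType} {M : metricType R} {n k : nat} (A : @Ck_atlas R M n k.+1).
Variable X : process R M.
Hypothesis X_cadlag : forall y (w : Omega X y), cadlag_from y (traj w).
Variables (y0 : M) (f : M -> homeo M) (c : M -> R).
Hypothesis f_plot : forall (V : normedModType R) (p q : V -> M) x,
  plot_at A p x -> plot_at A q x -> plot_at A (fun v => f (p v) (q v)) x.
Hypothesis fi_plot : forall (V : normedModType R) (p q : V -> M) x,
  plot_at A p x -> plot_at A q x -> plot_at A (fun v => homeo_inv (f (p v)) (q v)) x.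
Hypothesis c_plot : forall (V : normedModType R) (p : V -> M) x,
  plot_at A p x -> Ck_near k.+1 (c \o p) x.
Hypothesis c_gt0 : forall y, 0 < c y.
Hypothesis c_continuous : continuous c.
Hypothesis f_similar : forall y, similar X y0 y (f y) (c y).
Hypothesis f_y0 : forall x, f y0 x = x.
Hypothesis c_y0 : c y0 = 1.
Hypothesis f_return : forall y z, similar X y0 y0 (return_map f y z) (return_scale f c y z).
Hypothesis M_connected : connected [set: M].

(** Because [f y y0 = y]. A return scale that is not 1 everywhere is therefore non-constant. *)
Lemma return_scale_y0 y : return_scale f c y y0 = 1.
Proof.
have -> : return_scale f c y y0 = c y0 * c y * (c (f y y0))^-1 by [].
by rewrite (similar_point X_cadlag (f_similar y)) c_y0 mul1r mulfV ?gt_eqF.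
Qed.

Lemma return_map_plot y (V : normedModType R) (p q : V -> M) x :
  plot_at A p x -> plot_at A q x ->
  plot_at A (fun v => return_map f y (p v) (q v)) x /\
  plot_at A (fun v => homeo_inv (return_map f y (p v)) (q v)) x.
Proof.
move=> px qx; have cy := plot_cst A y x.
have fyp := f_plot cy px.
split; first by apply: (fi_plot fyp); apply: (f_plot cy); exact: f_plot.
by apply: (fi_plot px); apply: (fi_plot cy); exact: f_plot.
Qed.

Lemma return_scale_plot y (V : normedModType R) (p : V -> M) x :
  plot_at A p x -> Ck_near k.+1 (return_scale f c y \o p) x.
Proof.
move=> px; apply: Ck_near_mul.
  by apply: Ck_near_mul; [exact: c_plot|exact: Ck_near_cst].
apply: Ck_near_inv; first by rewrite gt_eqF.
by apply: (c_plot (p := fun v => f y (p v))); apply: f_plot => //; exact: plot_cst.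
Qed.

Lemma similar_pow h d (m : int) : similar X y0 y0 h (expR d) ->
  similar X y0 y0 (homeo_pow h m) (expR (d * m%:~R)).
Proof.
move=> hs; have it g e i : similar X y0 y0 g (expR e) ->
    similar X y0 y0 (iter i (homeo_comp g) homeo_id) (expR (e * i%:R)).
  move=> gs; elim: i => [|i IH].
    rewrite mulr0 expR0 => B mB; congr (_ _).
    by apply/seteqP; split=> w; rewrite /preimage/= rescale_id.
  rewrite mulrSr mulrDr mulr1 expRD; exact: (similar_comp (expR_gt0 e) IH gs).
case: m => i; first exact: it.
have -> : d * (Negz i)%:~R = (- d) * i.+1%:R by rewrite NegzE mulrNz mulrN mulNr.
by apply: it; rewrite expRN; apply: similar_sym => //; exact: expR_gt0.
Qed.

(** Return maps are followed along a curve in [M] where the return scale has non-zero speed, and the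
    curve is reparametrised so that the scale is exponential in [u]. Dividing by the return map at
    the start of the curve makes [L 0] the identity, with scale 1. *)
Lemma local_dilations y z1 : return_scale f c y z1 != 1 ->
  exists (L : R -> homeo M) (d : R), [/\ 0 < d, (forall x, L 0 x = x),
    (forall u, `|u| < 2 -> smooth_family A L u) &
    (forall u, `|u| < 2 -> similar X y0 y0 (L u) (expR (d * u)))].
Proof.
move=> rho1; pose rho := return_scale f c y.
have rhoc : continuous rho.
  have fy_c : continuous (f y) by exact: homeo_fun_continuous.
  move=> v; apply: cvgM.
    by apply: cvgM; [exact: c_continuous|exact: cvg_cst].
  apply: cvgV; first by rewrite gt_eqF.
  by apply: (@continuous_comp _ _ _ (f y) c); [exact: fy_c|exact: c_continuous].
have rho12 : rho z1 != rho y0 by rewrite [rho y0]return_scale_y0.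
have rho_gt0 z : 0 < rho z by exact: return_scale_gt0.
have [a [u0 [v [Aa au0 Dv]]]] := directional_derivative_neq0 (ltn0Sn k) M_connected
  rhoc (@return_scale_plot y) rho12.
pose line (t : R) : 'rV[R]_n := t *: v + u0.
have line_k t : Ck_near k.+1 line t.
  apply: Ck_near_add; last exact: Ck_near_cst.
  by apply: (Ck_near_scale (basis_row n)); exact: Ck_near_id.
have line0 : line 0 = u0 by rewrite /line scale0r add0r.
pose z (t : R) : M := param a (line t).
have z_plot t : chart_codom a (line t) -> plot_at A z t.
  by move=> at'; apply: (plot_comp (basis_row n) (f := line)) => //; exact: plot_param.
have z0_plot : plot_at A z 0 by apply: z_plot; rewrite line0.
pose phi (t : R) : R := rho (z t).
have phik : Ck_near k.+1 phi 0 by exact: return_scale_plot.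
have Dphi : 'D_1 phi 0 != 0.
  have rd : derivable (rho \o param a) u0 v.
    have /nbhs_singleton /= gC := return_scale_plot y (plot_param Aa au0).
    exact: Ck_derivable (gC) _ _ erefl.
  have /(iffLR (@is_derive_line _ _ _ (rho \o param a) u0 v 0 _)) [_] :
      is_derive (0 *: v + u0) v (rho \o param a) ('D_v (rho \o param a) u0).
    by rewrite -[0 *: v + u0]/(line 0) line0; exact: derivableP.
  by move=> ->.
have [g [g0 gK gk]] := local_inverse phik Dphi.
have near_good : \forall s \near phi 0,
    [/\ phi (g s) = s, Ck_near k.+1 g s & chart_codom a (line (g s))].
  have gc : \forall s \near phi 0, chart_codom a (line (g s)).
    have lg : {for phi 0, continuous (line \o g)}.
      apply: continuous_comp; first exact: Ck_near_continuous gk.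
      exact: Ck_near_continuous (line_k _).
    by apply: (lg (chart_codom a)); rewrite /= g0 line0; exact: chart_codom_nbhs.
  have gn := Ck_near_nbhs gk.
  by near=> s; split; [exact: (near gK s)|exact: (near gn s)|exact: (near gc s)].
have [d d0 dgood] : exists2 d : R, 0 < d & forall w, `|w| < d ->
    [/\ phi (g (phi 0 * expR w)) = phi 0 * expR w, Ck_near k.+1 g (phi 0 * expR w) &
        chart_codom a (line (g (phi 0 * expR w)))].
  have ec : {for 0, continuous (fun w => phi 0 * expR w)}.
    by apply: cvgM; [exact: cvg_cst|exact: continuous_expR].
  have : nbhs (0 : R) [set w | [/\ phi (g (phi 0 * expR w)) = phi 0 * expR w,
    Ck_near k.+1 g (phi 0 * expR w) &
        chart_codom a (line (g (phi 0 * expR w)))]].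
    apply: (ec [set s | [/\ phi (g s) = s, Ck_near k.+1 g s & chart_codom a (line (g s))]]).
    by rewrite /= expR0 mulr1.
  move=> /nbhs_ballP[d /= d0 dball]; exists d => // w wd; apply: dball.
  by rewrite -ball_normE /= sub0r normrN.
(* With this rate, [|u| < 2] is exactly what keeps [e * u] in the good range [|w| < d]. *)
pose e := d / 2.
have e0 : 0 < e by rewrite divr_gt0.
have ed u : `|u| < 2 -> `|e * u| < d.
  move=> u2; rewrite normrM (gtr0_norm e0) /e.
  by rewrite -ltr_pdivlMl// mulrC invf_div mulrC -mulrA [d^-1 * d]mulVf ?gt_eqF// mulr1.
(* The parameter of the curve at which the return scale is [expR (e * u)] times its initial
   value. *)
pose t (u : R) := g (phi 0 * expR (e * u)).
have t0 : t 0 = 0 by rewrite /t mulr0 expR0 mulr1.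
pose L (u : R) := homeo_comp (homeo_sym (return_map f y (z 0))) (return_map f y (z (t u))).
exists L, e; split => //.
- move=> x; rewrite /L t0 /homeo_comp /homeo_sym /comp.
  by move: (return_map f y (z 0)) => h; exact: homeo_funK.
- move=> u u2; have [_ gku chu] := dgood _ (ed _ u2).
  have tk : Ck_near k.+1 t u.
    apply: (Ck_near_comp basis_scalar basis_scalar (f := fun u =>
      phi 0 * expR (e * u)) (g := g : R^o -> R^o)) => //.
    apply: Ck_near_mul; first exact: Ck_near_cst.
    apply: Ck_near_expR; apply: Ck_near_mul; first exact: Ck_near_cst.
    exact: Ck_near_id.
  have zt : plot_at A (z \o t) u.
    by apply: (plot_comp basis_scalar (p := z : R^o -> M) (f := t : R^o -> R^o)) =>
      //; exact: z_plot.
  have s1 : smooth_family A (fun u => return_map f y (z (t u))) u.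
    move=> V al p x alk alu px; apply: return_map_plot => //.
    by apply: (plot_comp basis_scalar (p := z \o t : R^o -> M) (f := al : V -> R^o))
      => //; rewrite alu.
  apply: smooth_family_comp => //; apply: smooth_family_sym.
  by move=> V al p x alk alu px; apply: return_map_plot => //; exact: plot_cst.
- move=> u u2; have [phigu _ _] := dgood _ (ed _ u2).
  have -> : expR (e * u) = rho (z (t u)) * (rho (z 0))^-1.
    have -> : rho (z (t u)) = phi 0 * expR (e * u) by exact: phigu.
    have p0 : phi 0 != 0 by rewrite gt_eqF//; exact: rho_gt0.
    by rewrite -[rho (z 0)]/(phi 0) [RHS]mulrC mulKf.
  apply: similar_comp; [by rewrite invr_gt0|exact: f_return|].
  by apply: similar_sym => //; exact: f_return.
Unshelve. all: by end_near. Qed.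

End GoodComponents.

Section Globalization.
Context {R : realType} {M : metricType R} (X : process R M).
Variables (y0 : M) (k : nat) (L : R -> homeo M) (d : R).
Hypothesis L_similar : forall u, `|u| < 2 -> similar X y0 y0 (L u) (expR (d * u)).

(** Only scales are added up: the arguments [r - step k r], [step k r] and [m] sum to [u], so
    neither commutation nor a group law for [L] enters. *)
Lemma similar_globalize u : similar X y0 y0 (globalize k L u) (expR (d * u)).
Proof.
pose m := Num.floor u; pose r := u - m%:~R.
have /andP[ml mr] : m%:~R <= u < (m + 1)%:~R by exact: floor_itv.
have /andP[s0 s1] := step_itv k r.
rewrite intrD in mr.
have r0 : 0 <= r by rewrite subr_ge0.
have r1 : r < 1 by rewrite /r; lra.
have -> : d * u = d * (r - step k r) + d * step k r + d * m%:~R by rewrite /r; ring.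
rewrite !expRD; apply: similar_comp; first exact: expR_gt0.
  apply: similar_comp; first exact: expR_gt0.
    by apply: L_similar; rewrite ltr_norml; apply/andP; split; lra.
  by apply: L_similar; rewrite ger0_norm//; lra.
apply: similar_pow; rewrite -[in expR d](mulr1 d); apply: L_similar.
by rewrite normr1 ltr1n.
Qed.

End Globalization.

Lemma Ck_fun_of_plots {R : realType} {M : topologicalType} {n k : nat}
    (A : @Ck_atlas R M n k) (c : M -> R) : continuous c ->
  (forall (V : normedModType R) (p : V -> M) x, plot_at A p x -> Ck_near k (c \o p) x) ->
  Ck_fun A c.
Proof.
move=> cc ck; split=> // a Aa; apply/Ck_pointwise => u au.
exact: nbhs_singleton (ck _ _ _ (plot_param Aa au)).
Qed.

Lemma Ck_map2_of_plots {R : realType} {M : topologicalType} {n k : nat}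
    (A : @Ck_atlas R M n k) (F : M -> M -> M) :
  (forall (V : normedModType R) (p q : V -> M) x,
    plot_at A p x -> plot_at A q x -> plot_at A (fun v => F (p v) (q v)) x) ->
  Ck_map2 A F.
Proof.
move=> FA; apply: plot_Ck_map2 => a b u1 u2 Aa Ab au bu; apply: FA.
  apply: (plot_comp (basis_row n) (p := param a) (f := fst)); last exact: Ck_near_fst.
  exact: plot_param.
apply: (plot_comp (basis_row n) (p := param b) (f := snd)); last exact: Ck_near_snd.
exact: plot_param.
Qed.

Theorem proposition1p15 (R : realType) (k n : nat) (k_ge1 : (1 <= k)%N)
  (M : metricType R)
  (M_locally_compact : locally_compact [set: M])
  (M_separable : separable_space M)
  (M_connected : connected [set: M])
  (A : @Ck_atlas R M n k)
  (X : process R M)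
  (X_markov : strong_markov_cadlag X)
  (X_self_similar : exists (y1 : M) (f : M -> homeo M) (c : M -> R),
     invariance_components X y1 f c /\ Ck_components A f c)
  (y0 : M)
  (X_support : assumption1 X y0 \/ assumption2 X)
  (Sym_discrete : discrete_in_compact_convergence (Sym X y0)) :
  exists (f : M -> homeo M) (c : M -> R),
    good_components X y0 f c /\ Ck_components A f c.
Proof.
(* A successor order supplies the continuous first derivative that the local inverse needs. *)
case: k k_ge1 A X_self_similar => // k _ A.
move=> [y1 [f1 [c1 [[_ _ c1_gt0 c1_cont f1_sim] [f1_k f1i_k c1_k]]]]].
have X_cadlag := X_markov.1.
have f1_similar y : similar X y1 y (f1 y) (c1 y) by exact: f1_sim.
(* Change of reference point from [y1] to [y0], which also makes the component at [y0] trivial. *)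
pose f y := homeo_comp (f1 y) (homeo_sym (f1 y0)).
pose c y := (c1 y0)^-1 * c1 y.
have c_gt0 y : 0 < c y by rewrite mulr_gt0// invr_gt0.
have c_cont : continuous c by move=> y; apply: cvgM; [exact: cvg_cst|exact: c1_cont].
have f_plot (V : normedModType R) (p q : V -> M) x :
    plot_at A p x -> plot_at A q x -> plot_at A (fun v => f (p v) (q v)) x.
  move=> px qx; apply: (Ck_map2_plot f1_k px).
  by apply: (Ck_map2_plot f1i_k _ qx); exact: plot_cst.
have fi_plot (V : normedModType R) (p q : V -> M) x :
    plot_at A p x -> plot_at A q x -> plot_at A (fun v => homeo_inv (f (p v)) (q v)) x.
  move=> px qx; apply: (Ck_map2_plot f1_k (plot_cst A y0 x)).
  exact: (Ck_map2_plot f1i_k px).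
have c_plot (V : normedModType R) (p : V -> M) x : plot_at A p x -> Ck_near k.+1 (c \o p) x.
  by move=> px; apply: Ck_near_mul; [exact: Ck_near_cst|exact: Ck_fun_plot c1_k px].
have f_k : Ck_map2 A (fun y x => f y x) by exact: Ck_map2_of_plots.
have fi_k : Ck_map2 A (fun y x => homeo_inv (f y) x) by exact: Ck_map2_of_plots.
have f_similar y : similar X y0 y (f y) (c y).
  by apply: similar_comp (f1_similar y) => //; exact: similar_sym.
have f_y0 x : f y0 x = x by rewrite /= homeo_invK.
have c_y0 : c y0 = 1 by rewrite /c mulVf ?gt_eqF.
have full : Supp X y0 = setT.
  exact: (Supp_full X_markov f_k.1 c_gt0 f_similar M_connected X_support).
have f_return y z : similar X y0 y0 (return_map f y z) (return_scale f c y z).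
  by apply: (similar_return X_markov M_separable f_k.1 fi_k.1) => //; rewrite full.
have [|H] := pselect (exists y z, return_scale f c y z != 1); last first.
  exists f, c; split; last by split=> //; exact: Ck_fun_of_plots.
  split=> //; first by split=> //; [exact: f_k.1|exact: fi_k.1].
  move=> y z; have : return_scale f c y z = 1.
    by apply/eqP; apply: contrapT => yz; apply: H; exists y, z; apply/negP.
  by rewrite /return_scale => /divr1_eq <-; rewrite mulrC.
move=> [y [z yz]].
have [L [d [d0 L0 L_smooth L_sim]]] := local_dilations X_cadlag f_plot fi_plot c_plot c_gt0
  c_cont f_similar c_y0 f_return M_connected yz.
pose G (u : R) := globalize k.+1 L u.
(* The solution of [expR (d * u y) * c y = 1]. *)
pose u y := - (d^-1 * ln (c y)).
pose g y := homeo_comp (f y) (G (u y)).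
have u_plot (V : normedModType R) (p : V -> M) x : plot_at A p x -> Ck_near k.+1 (u \o p) x.
  move=> px.
  have -> : u \o p = fun v => (- d^-1) * ln (c (p v)) by apply/funext => v;
    rewrite /u /= mulNr.
  apply: Ck_near_mul; first exact: Ck_near_cst.
  by apply: Ck_near_ln => //; exact: c_plot.
have G_plot (V : normedModType R) (p q : V -> M) x : plot_at A p x -> plot_at A q x ->
    plot_at A (fun v => G (u (p v)) (q v)) x /\ plot_at A (fun v =>
      homeo_inv (G (u (p v))) (q v)) x.
  move=> px qx; have Gs := @globalize_smooth _ _ _ k.+1 A L L0 L_smooth (u (p x)).
  exact: (Gs V (u \o p) q x (u_plot _ _ _ px) erefl qx).
have g_plot (V : normedModType R) (p q : V -> M) x :
    plot_at A p x -> plot_at A q x -> plot_at A (fun v => g (p v) (q v)) x.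
  by move=> px qx; apply: (f_plot _ _ _ _ px); have [] := G_plot _ _ _ _ px qx.
have gi_plot (V : normedModType R) (p q : V -> M) x :
    plot_at A p x -> plot_at A q x -> plot_at A (fun v => homeo_inv (g (p v)) (q v)) x.
  by move=> px qx; have [] := G_plot _ _ _ _ px (fi_plot _ _ _ _ px qx).
have g_k : Ck_map2 A (fun y x => g y x) by exact: Ck_map2_of_plots.
have gi_k : Ck_map2 A (fun y x => homeo_inv (g y) x) by exact: Ck_map2_of_plots.
exists g, (fun=> 1); split; last first.
  split=> //; apply: Ck_fun_of_plots; first by move=> ?; exact: cvg_cst.
  by move=> V p x _; exact: Ck_near_cst.
split=> //; last 2 first.
(* At the reference point [ln (c y0) = 0], so [G] contributes the identity and the normalisation
   survives. *)
- move=> x; rewrite /g /u c_y0 ln1 mulr0 oppr0 /=.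
  by rewrite homeo_invK; exact: globalize0.
- by move=> _ _; rewrite mulr1.
split=> //; [exact: g_k.1|exact: gi_k.1|by move=> ?; exact: cvg_cst|].
move=> v; have s := similar_comp (c_gt0 v) (similar_globalize k.+1 L_sim (u v))
  (f_similar v).
have E : expR (d * u v) * c v = 1.
  rewrite /u mulrN mulVKf ?gt_eqF// expRN lnK ?posrE//.
  by rewrite mulVf ?gt_eqF.
by rewrite E in s.
Qed.
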